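(* Let $(\delta_n)_{n=1}^\infty$ be a sequence of real numbers with $1<\delta_n$ for all $n$ and $\delta_n\to\infty$. There exist $n_0\in\mathbb N$ and a twisted Hilbert space $Z$ such that $d_n(Z)\leq\delta_n$ for all $n\geq n_0$. Moreover, $Z$ is not asymptotically Hilbertian.
   Context: All Banach spaces are complex. A twisted Hilbert space is a Banach space $Z$ having a closed subspace $Y$ isomorphic to $\ell_2$ such that $Z/Y$ is isomorphic to $\ell_2$. For a finite-dimensional space $E$, $d_E=d(E,\ell_2^{\dim E})$ is the Banach-Mazur distance; $d_n(Z)=\sup d_E$, the supremum over all $n$-dimensional subspaces $E$ of $Z$. A space $X$ is asymptotically Hilbertian if there is $C>0$ such that for every $n\in\mathbb N$ there is a finite-codimensional subspace $X_n$ of $X$ so that every $n$-dimensional subspace $E$ of $X_n$ satisfies $d_E\le C$. *)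

(* Defs.v *)
From HB Require Import structures.
From mathcomp Require Import all_boot all_order all_algebra.
From mathcomp Require Import complex ring_quotient.
From mathcomp Require Import ring.
From mathcomp Require Import all_classical all_reals all_analysis.

Set Implicit Arguments.
Unset Strict Implicit.
Unset Printing Implicit Defensive.

Import Order.TTheory GRing.Theory Num.Theory.
Import numFieldNormedType.Exports.

Local Open Scope classical_set_scope.
Local Open Scope ring_scope.
Local Open Scope complex_scope.
Local Open Scope quotient_scope.

(* In a normed module over R[i] the library norm `|x| is an element of R[i]
   lying on the nonnegative real axis; [rnorm x] is the same number in R. *)
Definition rnorm (R : realType) (V : normedZmodType R[i]) (x : V) : R :=
  complex.Re `|x|.

Section RealNorm.
Context {R : realType}.
Local Notation C := R[i].
Implicit Types V : normedZmodType C.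

Lemma rnormE V (x : V) : `|x| = (rnorm x)%:C.
Proof.
by rewrite /rnorm RRe_real ?normr_real.
Qed.

Lemma rnorm_ge0 V (x : V) : 0 <= rnorm x.
Proof. by rewrite -ler0c -rnormE. Qed.

Lemma rnormD V (x y : V) : rnorm (x + y) <= rnorm x + rnorm y.
Proof. by rewrite -lecR rmorphD /= -!rnormE ler_normD. Qed.

Lemma rnorm0 V : rnorm (0 : V) = 0.
Proof. by rewrite /rnorm normr0. Qed.

Lemma rnorm_eq0 V (x : V) : rnorm x = 0 -> x = 0.
Proof. by move=> x0; apply/eqP; rewrite -normr_eq0 rnormE x0. Qed.

Lemma rnormZ (V : normedModType C) (l : C) (x : V) :
  rnorm (l *: x) = rnorm l * rnorm x.
Proof.
by apply: (@complexI R); rewrite rmorphM /= -!rnormE normrZ.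
Qed.

Lemma rnormM (l x : C) : rnorm (l * x) = rnorm l * rnorm x.
Proof.
by apply: (@complexI R); rewrite rmorphM /= -!rnormE normrM.
Qed.

End RealNorm.

(* A linear subspace, not assumed closed. *)
Record lsubspace (R : realType) (V : lmodType R[i]) := LSubspace {
  carrier :> {pred V};
  subspaceP : submod_closed carrier
}.

Section SubspaceInstances.
Context {R : realType} {V : lmodType R[i]}.

HB.instance Definition _ (S : lsubspace V) :=
  GRing.isSubmodClosed.Build R[i] V (carrier S) (subspaceP S).

Lemma subspace_opp (S : lsubspace V) : oppr_closed S.
Proof. by move=> x xS; rewrite -scaleN1r rpredZ. Qed.

HB.instance Definition _ (S : lsubspace V) :=
  GRing.isOppClosed.Build V (carrier S) (@subspace_opp S).

End SubspaceInstances.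

Definition subspace_type (R : realType) (V : lmodType R[i]) (S : lsubspace V)
  : Type := {x : V | x \in carrier S}.

Section SubspaceType.
Context {R : realType} {V : lmodType R[i]} (S : lsubspace V).
HB.instance Definition _ := SubChoice.on (subspace_type S).
HB.instance Definition _ := [SubChoice_isSubLmodule of subspace_type S by <:].
End SubspaceType.

Section NormedSubspace.
Context {R : realType} {V : normedModType R[i]} (S : lsubspace V).

Let nrm (x : subspace_type S) : R[i] := `|val x|.

Let nrmD x y : nrm (x + y) <= nrm x + nrm y.
Proof. by rewrite /nrm raddfD ler_normD. Qed.

Let nrmZ l x : nrm (l *: x) = `|l| * nrm x.
Proof. by rewrite /nrm linearZ /= normrZ. Qed.

Let nrm0 x : nrm x = 0 -> x = 0.
Proof. by move=> /normr0_eq0 x0; apply: val_inj; rewrite x0 raddf0. Qed.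

HB.instance Definition _ :=
  Lmodule_isNormed.Build R[i] (subspace_type S) nrmD nrmZ nrm0.

Lemma norm_subspaceE (x : subspace_type S) : `|x| = `|val x|.
Proof. by []. Qed.

End NormedSubspace.

Definition quotient_space (R : realType) (V : lmodType R[i]) (S : lsubspace V)
  : Type := Quotient.quot (carrier S).

Section QuotientType.
Context {R : realType} {V : lmodType R[i]} (S : lsubspace V).
Local Notation C := R[i].
Local Notation Q := (quotient_space S).

HB.instance Definition _ := Choice.on Q.
HB.instance Definition _ := EqQuotient.on Q.
HB.instance Definition _ := GRing.Zmodule.on Q.

Definition quotient_proj (x : V) : Q := \pi_Q x.

Lemma quotient_projE (x y : V) :
  (quotient_proj x == quotient_proj y) = (x - y \in carrier S).
Proof. by rewrite Quotient.idealrBE. Qed.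

Lemma quotient_projD : {morph quotient_proj : x y / x + y >-> x + y}.
Proof. by move=> x y; rewrite /quotient_proj Quotient.pi_add. Qed.

Lemma quotient_projK (q : Q) : quotient_proj (repr q) = q.
Proof. exact: reprK. Qed.

Definition quotient_scale (a : C) (q : Q) : Q := quotient_proj (a *: repr q).

Lemma quotient_projZ a x :
  quotient_proj (a *: x) = quotient_scale a (quotient_proj x).
Proof.
apply/eqP; rewrite quotient_projE -scalerBr rpredZ//.
by rewrite -quotient_projE quotient_projK.
Qed.

Let scaleA a b q :
  quotient_scale a (quotient_scale b q) = quotient_scale (a * b) q.
Proof. by rewrite -(quotient_projK q) -!quotient_projZ scalerA. Qed.

Let scale1 : left_id 1 quotient_scale.
Proof. by move=> q; rewrite /quotient_scale scale1r quotient_projK. Qed.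

Let scaleDr : right_distributive quotient_scale +%R.
Proof.
move=> a p q; rewrite -(quotient_projK p) -(quotient_projK q).
by rewrite -quotient_projD -!quotient_projZ scalerDr quotient_projD.
Qed.

Let scaleDl q : {morph quotient_scale^~ q : a b / a + b}.
Proof.
move=> a b; rewrite -(quotient_projK q).
by rewrite -!quotient_projZ scalerDl quotient_projD.
Qed.

HB.instance Definition _ :=
  GRing.Zmodule_isLmodule.Build C Q scaleA scale1 scaleDr scaleDl.

Lemma quotient_proj_linear : linear quotient_proj.
Proof. by move=> a x y; rewrite quotient_projD quotient_projZ. Qed.

HB.instance Definition _ :=
  GRing.isLinear.Build C V Q _ quotient_proj quotient_proj_linear.

End QuotientType.

(* The quotient norm separates points only for a closed subspace, hence the
   extra argument of this copy of [quotient_space S]. *)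
Definition normed_quotient (R : realType) (V : normedModType R[i])
  (S : lsubspace V) (clS : closed [set x | x \in carrier S]) : Type :=
  quotient_space S.

Section NormedQuotient.
Context {R : realType} {V : normedModType R[i]} (S : lsubspace V).
Context (clS : closed [set x | x \in carrier S]).
Local Notation C := R[i].
Local Notation Q := (normed_quotient clS).

HB.instance Definition _ := GRing.Lmodule.on Q.

Definition coset_norms (q : Q) : set R :=
  [set rnorm x | x in [set x : V | quotient_proj S x = q]].

Definition quotient_norm (q : Q) : C := (inf (coset_norms q))%:C.

Let lb0 q : lbound (coset_norms q) 0.
Proof. by move=> _ [x _ <-]; exact: rnorm_ge0. Qed.

Let coset_has_inf q : has_inf (coset_norms q).
Proof.
split; last by exists 0.
by exists (rnorm (repr (q : quotient_space S))), (repr (q : quotient_space S));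
  rewrite //= quotient_projK.
Qed.

Let inf_le q x : quotient_proj S x = q -> inf (coset_norms q) <= rnorm x.
Proof. by move=> qx; apply: ge_inf; [exists 0 | exists x]. Qed.

Let inf_ge0 q : 0 <= inf (coset_norms q).
Proof. by apply: lb_le_inf => //; case: (coset_has_inf q). Qed.

Let nrmD p q : quotient_norm (p + q) <= quotient_norm p + quotient_norm q.
Proof.
rewrite /quotient_norm -rmorphD /= lecR; apply/ler_addgt0Pr => e e0.
have e20 : 0 < e / 2 by rewrite divr_gt0.
have [_ [x xp <-] lx] := inf_adherent e20 (coset_has_inf p).
have [_ [y yq <-] ly] := inf_adherent e20 (coset_has_inf q).
apply: (@le_trans _ _ (rnorm (x + y))).
  by apply: inf_le; rewrite quotient_projD xp yq.
rewrite (le_trans (rnormD _ _))// [e]splitr addrACA.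
by rewrite lerD// ltW.
Qed.

Let nrmZ_le (l : C) (q : Q) :
  inf (coset_norms (l *: q)) <= rnorm l * inf (coset_norms q).
Proof.
apply/ler_addgt0Pr => e e0.
have d0 : 0 < e / (rnorm l + 1).
  by rewrite divr_gt0// ltr_wpDl// rnorm_ge0.
have [_ [x xq <-] lx] := inf_adherent d0 (coset_has_inf q).
apply: (@le_trans _ _ (rnorm (l *: x))).
  by apply: inf_le; rewrite quotient_projZ xq.
rewrite rnormZ (le_trans (ler_wpM2l (rnorm_ge0 _) (ltW lx)))//.
rewrite mulrDr lerD2l mulrCA ler_piMr// ?(ltW e0)//.
rewrite ler_pdivrMr ?mul1r ?lerDl//.
by rewrite ltr_wpDl// rnorm_ge0.
Qed.

Let nrmZ l q : quotient_norm (l *: q) = `|l| * quotient_norm q.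
Proof.
rewrite (rnormE (l : C)) /quotient_norm -rmorphM; congr (_%:C).
apply/eqP; rewrite eq_le nrmZ_le /=.
have [->|l0] := eqVneq l 0; first by rewrite rnorm0 mul0r.
have rl0 : 0 < rnorm l.
  by rewrite lt_neqAle rnorm_ge0 andbT eq_sym; apply: contra l0 => /eqP/rnorm_eq0->.
rewrite -ler_pdivlMl//.
have := nrmZ_le l^-1 (l *: q); rewrite scalerA mulVf// scale1r.
by rewrite /rnorm normfV (rnormE l) -fmorphV.
Qed.

Let nrm0 q : quotient_norm q = 0 -> q = 0.
Proof.
move=> q0; have {}q0 : inf (coset_norms q) = 0 by exact: (@complexI R).
rewrite -(quotient_projK (q : quotient_space S)); set x := repr _.
suff : x \in carrier S.
  by rewrite -{1}(subr0 x) -quotient_projE => /eqP ->; rewrite linear0.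
apply: clS => B /nbhs_ballP[e e0 eB].
have [re0 eE] : 0 < complex.Re e /\ e = (complex.Re e)%:C.
  by rewrite RRe_real ?gtr0_real// -ltcR RRe_real ?gtr0_real.
have [_ [y yq <-]] := inf_adherent re0 (coset_has_inf q).
rewrite q0 add0r => ye; exists (x - y); split.
  by rewrite /= -quotient_projE yq quotient_projK.
apply: eB; rewrite -ball_normE /= opprB addrCA subrr addr0.
by rewrite rnormE eE ltcR.
Qed.

HB.instance Definition _ := Lmodule_isNormed.Build C Q nrmD nrmZ nrm0.

Lemma norm_quotientE (q : Q) : `|q| = quotient_norm q.
Proof. by []. Qed.

End NormedQuotient.

Definition ell2_sqnorm (R : realType) (I : choiceType) (x : I -> R[i])
  : \bar R := \esum_(i in [set: I]) (rnorm (x i) ^+ 2)%:E.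

Definition square_summable (R : realType) (I : choiceType) : {pred I -> R[i]} :=
  fun x => `[< (ell2_sqnorm x < +oo)%E >].

(* [ell2 R nat] is the complex space \ell_2, and [ell2 R 'I_n] is \ell_2^n. *)
Definition ell2 (R : realType) (I : choiceType) : Type :=
  {x : I -> R[i] | x \in @square_summable R I}.

Section Ell2.
Context {R : realType} {I : choiceType}.
Local Notation C := R[i].
Implicit Types x y : I -> C.


Lemma ell2_sqnorm_ge0 x : (0 <= ell2_sqnorm x)%E.
Proof. by apply: esum_ge0 => i _; rewrite lee_fin sqr_ge0. Qed.

Lemma ell2_sqnormZ (a : C) x :
  (ell2_sqnorm (a *: x) = (rnorm a ^+ 2)%:E * ell2_sqnorm x)%E.
Proof.
rewrite /ell2_sqnorm /esum -ereal_supZl ?sqr_ge0//; last first.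
  by apply/set0P; exists 0%E, set0; [exact: fsets_set0 | rewrite fsbig_set0].
rewrite image_comp; congr ereal_sup; apply: eq_imagel => A _ /=.
rewrite ge0_mule_fsumr; last by move=> i; rewrite lee_fin sqr_ge0.
by apply: eq_fsbigr => i _; rewrite rnormM exprMn EFinM.
Qed.

Let sqrD_le (t a b : R) : 0 < t ->
  (a + b) ^+ 2 <= (1 + t) * a ^+ 2 + (1 + t^-1) * b ^+ 2.
Proof.
move=> t0; rewrite -subr_ge0.
rewrite (_ : _ - _ = (t * a - b) ^+ 2 / t); last by field; rewrite gt_eqF.
by rewrite divr_ge0 ?sqr_ge0 ?ltW.
Qed.

Lemma ell2_sqnormD_le (t : R) x y : 0 < t ->
  (ell2_sqnorm (x + y)%R <=
   (1 + t)%:E * ell2_sqnorm x + (1 + t^-1)%:E * ell2_sqnorm y)%E.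
Proof.
move=> t0.
have st (s : R) : 0 < s -> rnorm ((Num.sqrt (1 + s))%:C : C) ^+ 2 = 1 + s.
  move=> s0; rewrite /rnorm ger0_norm ?ler0c ?sqrtr_ge0//= sqr_sqrtr//.
  by rewrite addr_ge0// ltW.
rewrite -(st t)// -(st t^-1) ?invr_gt0// -!ell2_sqnormZ.
rewrite /ell2_sqnorm -esumD; last 2 first.
- by move=> i _; rewrite lee_fin sqr_ge0.
- by move=> i _; rewrite lee_fin sqr_ge0.
apply: le_esum => i _; rewrite -EFinD lee_fin !rnormM !exprMn.
rewrite !st ?invr_gt0// (le_trans _ (sqrD_le _ _ t0))//.
by rewrite lerXn2r ?nnegrE ?addr_ge0 ?rnorm_ge0// rnormD.
Qed.

Lemma square_summable_submod : submod_closed (@square_summable R I).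
Proof.
split=> [|a x y /asboolP xoo /asboolP yoo]; apply/asboolP.
  rewrite /ell2_sqnorm esum1 ?ltry// => i _.
  by rewrite rnorm0 expr0n.
apply: (le_lt_trans (ell2_sqnormD_le _ _ ltr01)).
rewrite ell2_sqnormZ -(fineK (x := ell2_sqnorm x)); last first.
  by rewrite ge0_fin_numE ?ell2_sqnorm_ge0.
rewrite -(fineK (x := ell2_sqnorm y)) ?ge0_fin_numE ?ell2_sqnorm_ge0//.
by rewrite -!EFinM -EFinD ltry.
Qed.

HB.instance Definition _ :=
  GRing.isSubmodClosed.Build C (I -> C) (@square_summable R I)
    square_summable_submod.

HB.instance Definition _ := SubChoice.on (ell2 R I).
HB.instance Definition _ := [SubChoice_isSubLmodule of ell2 R I by <:].

Definition ell2_norm (x : ell2 R I) : C :=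
  (Num.sqrt (fine (ell2_sqnorm (val x))))%:C.

Let nx (x : ell2 R I) : R := Num.sqrt (fine (ell2_sqnorm (val x))).

Let sqnormE (x : ell2 R I) : ell2_sqnorm (val x) = (nx x ^+ 2)%:E.
Proof.
rewrite sqr_sqrtr ?fine_ge0 ?ell2_sqnorm_ge0// fineK//.
by rewrite ge0_fin_numE ?ell2_sqnorm_ge0//; exact: asboolW (valP x).
Qed.

Let nx0 (x : ell2 R I) : nx x = 0 -> x = 0.
Proof.
move=> x0; apply: val_inj; apply/funext => i /=; apply: rnorm_eq0.
have : ((rnorm (val x i) ^+ 2)%:E <= ell2_sqnorm (val x))%E.
  apply: esum_ge; exists [set i]; last by rewrite fsbig_set1.
  by split=> //; exact: finite_set1.
rewrite sqnormE x0 expr0n lee_fin => h; apply/eqP.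
by rewrite -sqrf_eq0 eq_le h sqr_ge0.
Qed.

Let nrmD (x y : ell2 R I) : ell2_norm (x + y) <= ell2_norm x + ell2_norm y.
Proof.
rewrite /ell2_norm -rmorphD /= lecR.
change (nx (x + y) <= nx x + nx y).
have [x0|x0] := eqVneq (nx x) 0; first by rewrite x0 (nx0 x0) !add0r.
have [y0|y0] := eqVneq (nx y) 0; first by rewrite y0 (nx0 y0) !addr0.
have {}x0 : 0 < nx x by rewrite lt_neqAle eq_sym x0 sqrtr_ge0.
have {}y0 : 0 < nx y by rewrite lt_neqAle eq_sym y0 sqrtr_ge0.
rewrite -(@ler_pXn2r _ 2) ?nnegrE ?addr_ge0 ?sqrtr_ge0// -lee_fin -sqnormE.
rewrite raddfD (le_trans (ell2_sqnormD_le _ _ (divr_gt0 y0 x0)))//.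
rewrite !sqnormE -!EFinM -EFinD lee_fin le_eqVlt; apply/orP; left; apply/eqP.
by field; rewrite !gt_eqF.
Qed.

Let nrmZ a (x : ell2 R I) : ell2_norm (a *: x) = `|a| * ell2_norm x.
Proof.
rewrite (rnormE (a : C)) /ell2_norm -rmorphM; congr (_%:C).
rewrite linearZ /= ell2_sqnormZ sqnormE -EFinM /= sqrtrM ?sqr_ge0//.
by rewrite !sqrtr_sqr !ger0_norm ?rnorm_ge0 ?sqrtr_ge0.
Qed.

Let nrm0 (x : ell2 R I) : ell2_norm x = 0 -> x = 0.
Proof. by move=> /(@complexI R); exact: nx0. Qed.

HB.instance Definition _ := Lmodule_isNormed.Build C (ell2 R I) nrmD nrmZ nrm0.

Lemma norm_ell2E (x : ell2 R I) : `|x| = ell2_norm x.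
Proof. by []. Qed.

End Ell2.

Section BanachSpaceNotions.
Context {R : realType}.
Local Notation C := R[i].

Definition is_basis (V : lmodType C) (n : nat) (b : 'I_n -> V) : Prop :=
  (forall c : 'I_n -> C, \sum_i c i *: b i = 0 -> forall i, c i = 0) /\
  (forall x : V, exists c : 'I_n -> C, x = \sum_i c i *: b i).

Definition has_dim (n : nat) (V : lmodType C) : Prop :=
  exists b : 'I_n -> V, is_basis b.

Definition finite_codim (V : lmodType C) (S : lsubspace V) : Prop :=
  exists k : nat, has_dim k (quotient_space S).

Definition isomorphism_pair (X Y : normedModType C)
    (f : {linear X -> Y}) (g : {linear Y -> X}) : Prop :=
  [/\ cancel f g, cancel g f, continuous f & continuous g].

Definition isomorphic (X Y : normedModType C) : Prop :=
  exists (f : {linear X -> Y}) (g : {linear Y -> X}), isomorphism_pair f g.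

Definition opnorm (X Y : normedModType C) (f : {linear X -> Y}) : \bar R :=
  ereal_sup [set (rnorm (f x))%:E | x in [set x : X | rnorm x <= 1]].

(* The infimum of the empty set is +oo: non-isomorphic spaces are at distance
   +oo. *)
Definition banach_mazur (X Y : normedModType C) : \bar R :=
  ereal_inf [set d | exists (f : {linear X -> Y}) (g : {linear Y -> X}),
    isomorphism_pair f g /\ d = (opnorm f * opnorm g)%E].

Definition twisted_hilbert (Z : completeNormedModType C) : Prop :=
  exists (Y : lsubspace Z) (clY : closed [set x | x \in carrier Y]),
    isomorphic (subspace_type Y) (ell2 R nat) /\
    isomorphic (normed_quotient clY) (ell2 R nat).

(* The distance d_E of E to \ell_2^n; only meaningful when dim E = n. *)
Definition hilbert_dist (Z : normedModType C) (n : nat) (E : lsubspace Z)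
  : \bar R := banach_mazur (subspace_type E) (ell2 R 'I_n).

(* d_n(Z) *)
Definition max_hilbert_dist (n : nat) (Z : normedModType C) : \bar R :=
  ereal_sup [set d | exists2 E : lsubspace Z,
    has_dim n (subspace_type E) & d = hilbert_dist n E].

Definition asymptotically_hilbertian (X : normedModType C) : Prop :=
  exists2 c : R, 0 < c & forall n : nat,
    exists2 Xn : lsubspace X, finite_codim Xn &
      forall E : lsubspace X, {subset carrier E <= carrier Xn} ->
        has_dim n (subspace_type E) -> (hilbert_dist n E <= c%:E)%E.

End BanachSpaceNotions.

(* Main.v *)
From HB Require Import structures.
Require Import Defs.
From mathcomp Require Import all_boot all_order all_algebra.
From mathcomp Require Import complex.
From mathcomp Require Import ring lra.
From mathcomp Require Import all_classical all_reals all_analysis.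

Import Order.TTheory GRing.Theory Num.Theory.
Import numFieldNormedType.Exports.

Local Open Scope classical_set_scope.
Local Open Scope ring_scope.

(** Let [Phi] be a capped Kalton-Peck map.  The coordinates are split into
    infinite groups, each of which has a level [k], and [Phi a] multiplies the
    coordinates of [a] in a group [g] of level [k] by [f g s], where [s] is the
    l2 norm of the part of [a] that lives in [g] and
    [f g s = min (k, - eps k * ln s)].  The inequality
    [s * t * `|f g s - f g t| <= eps k * (s ^+ 2 + t ^+ 2)]
    ([caplog_lipschitz]) makes [Phi] almost symmetric for the bilinear pairing:
    [<Phi x, a> - <x, Phi a>] is at most [2 * eps] on the unit ball when all
    the groups met by [x] have [eps k <= eps] ([weight_almost_symmetric]).

    The space [Z] consists of the pairs [(y, x)] on which the functionals
    [<y, a> + <x, Phi a>] and [<x, a>], for [a] finitely supported in the unit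
    ball, are bounded; its norm is the supremum of their moduli.  As a supremum
    of seminorms this is a norm although [Phi] is not linear, and [Z] is
    complete because each functional reads finitely many coordinates
    ([twisted_cauchy_cvg]).  The pairs [(y, 0)] form an isometric copy of l2,
    and by almost symmetry [(- Phi x, x)] has norm at most 2 for [x] in the
    unit ball, so the quotient is isomorphic to l2 through the second
    component ([twisted_hilbert_twisted]).

    Upper bound ([hilbert_dist_twisted_le]).  Let [E] be an n-dimensional
    subspace, and [K] a level with [2 * n * eps K <= 1].  On the groups of
    level at least [K], replace [Phi] by the linear map that agrees with it on
    an orthonormal basis of the projection of [E] to these groups: by almost
    symmetry this changes the functionals by at most [2 * n * eps K] times the
    norm of [x].  On the other groups [Phi] is bounded by [K].  So after
    subtracting a linear map from [y], the norm of [E] is that of a subspace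
    of a direct sum of two Hilbert spaces, and [E] is at distance at most
    [(3 + K) * (2 + K)] from Hilbert space, whatever the levels above [K] look
    like.  It remains to choose [eps K] so small that [2 * n * eps K <= 1]
    holds as long as [delta n] may lie below the bound for [K + 1].

    Lower bound ([far_subspace_of_finite_codim]).  Choose unit vectors of the
    second component in [m] different groups of level [k].  They have norm at
    most 1 in [Z], since [s * f g s] stays at most 1.  The sum of these vectors
    with arbitrary signs, tested against its own normalisation, has in each
    group a part of norm [1 / sqrt m], where [f g] takes its maximal value [k]
    if [m] is large; so its norm is at least [k * sqrt m].  In a Hilbert space
    some choice of signs gives a sum of norm at most [sqrt m]
    ([choose_signs]), hence the span is at distance at least [k] from Hilbert
    space ([banach_mazur_ge]).  Inside a group [Phi] depends on the norm alone,
    so that any unit vector of the group can be used; since groups are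
    infinite, linear algebra finds such vectors in every subspace of finite
    codimension ([combination_in_finite_codim]). *)

Set Implicit Arguments.
Unset Strict Implicit.

(** * Real-valued norms *)

Section ModulusAndSums.
Context {R : realType}.
Local Notation C := R[i].
Implicit Types (V : normedZmodType C) (z w : C) (r : R).

Lemma rnormN V (x : V) : rnorm (- x) = rnorm x.
Proof. by rewrite /rnorm normrN. Qed.

Lemma rnorm_sum V (I : Type) (s : seq I) (P : pred I) (F : I -> V) :
  rnorm (\sum_(i <- s | P i) F i) <= \sum_(i <- s | P i) rnorm (F i).
Proof.
elim/big_ind2: _ => [|x a y b xa yb|//]; first by rewrite rnorm0.
by rewrite (le_trans (rnormD _ _))// lerD.
Qed.

Lemma rnorm_real r : rnorm (r%:C : C)%C = `|r|.
Proof. by rewrite /rnorm normc_def /= expr0n addr0 sqrtr_sqr. Qed.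

Lemma rnorm_conj z : rnorm z^* = rnorm z.
Proof. by rewrite /rnorm norm_conjC. Qed.

Lemma mul_conj z : z * z^* = ((rnorm z ^+ 2)%:C)%C.
Proof. by rewrite -normCK rnormE rmorphXn. Qed.

Lemma rnorm1 : rnorm (1 : C) = 1.
Proof. by rewrite /rnorm normr1. Qed.

End ModulusAndSums.

(** * Square-summable sequences *)

Section SquareSums.
Context {R : realType}.
Local Notation C := R[i].
Implicit Types (a x y : nat -> C) (p q B : R) (n : nat).

Definition sqsum n x : R := \sum_(i < n) rnorm (x i) ^+ 2.

Definition l2norm x : R := Num.sqrt (fine (ell2_sqnorm x)).

Lemma sqsum_ge0 n x : 0 <= sqsum n x.
Proof. by apply: sumr_ge0 => i _; rewrite sqr_ge0. Qed.

Lemma le_sqsum n m x : (n <= m)%N -> sqsum n x <= sqsum m x.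
Proof.
move=> nm; rewrite /sqsum -!(big_mkord xpredT (fun i => rnorm (x i) ^+ 2)).
by rewrite (@big_cat_nat _ _ _ n 0 m)//= lerDl sumr_ge0// => i _; rewrite sqr_ge0.
Qed.

Lemma l2norm_ge0 x : 0 <= l2norm x. Proof. exact: sqrtr_ge0. Qed.

Lemma ell2_sqnorm_series x :
  ell2_sqnorm x = (\sum_(0 <= i <oo) (rnorm (x i) ^+ 2)%:E)%E.
Proof. by rewrite nneseries_esumT// => n; rewrite lee_fin sqr_ge0. Qed.

Lemma sqsum_le_sqnorm n x : ((sqsum n x)%:E <= ell2_sqnorm x)%E.
Proof.
rewrite ell2_sqnorm_series /sqsum -sumEFin.
rewrite -(big_mkord xpredT (fun i => (rnorm (x i) ^+ 2)%:E)).
by apply: nneseries_lim_ge => i _ _; rewrite lee_fin sqr_ge0.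
Qed.

Lemma sqnorm_le x B :
  (forall n, sqsum n x <= B) -> (ell2_sqnorm x <= B%:E)%E.
Proof.
move=> xB; rewrite ell2_sqnorm_series; apply: lime_le.
  by apply: is_cvg_nneseries => i _ _; rewrite lee_fin sqr_ge0.
by near=> n; rewrite sumEFin big_mkord lee_fin; exact: xB.
Unshelve. all: by end_near. Qed.

Lemma sqnormE x :
  x \in @square_summable R nat -> ell2_sqnorm x = (l2norm x ^+ 2)%:E.
Proof.
move=> xs; rewrite sqr_sqrtr ?fine_ge0 ?ell2_sqnorm_ge0// fineK//.
by rewrite ge0_fin_numE ?ell2_sqnorm_ge0//; exact: asboolW xs.
Qed.

Lemma sqsum_le_l2norm n x :
  x \in @square_summable R nat -> sqsum n x <= l2norm x ^+ 2.
Proof. by move=> xs; rewrite -lee_fin -sqnormE// sqsum_le_sqnorm. Qed.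

Lemma bounded_square_summable x B :
  (forall n, sqsum n x <= B) -> x \in @square_summable R nat.
Proof. by move=> xB; apply/asboolP; rewrite (le_lt_trans (sqnorm_le xB)) ?ltry. Qed.

Lemma l2norm_le x p : 0 <= p -> (forall n, sqsum n x <= p ^+ 2) -> l2norm x <= p.
Proof.
move=> p0 xp; rewrite -(@ler_pXn2r _ 2) ?nnegrE ?l2norm_ge0//.
rewrite -lee_fin -sqnormE; first exact: sqnorm_le.
exact: bounded_square_summable xp.
Qed.

Lemma le_l2norm x y : (forall i, rnorm (x i) <= rnorm (y i)) ->
  y \in @square_summable R nat -> x \in @square_summable R nat /\ l2norm x <= l2norm y.
Proof.
move=> xy ys; have xle n : sqsum n x <= l2norm y ^+ 2.
  apply: le_trans (sqsum_le_l2norm n ys); apply: ler_sum => i _.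
  by rewrite lerXn2r ?nnegrE ?rnorm_ge0.
by split; [exact: bounded_square_summable xle | exact: l2norm_le (l2norm_ge0 _) xle].
Qed.

Lemma rnorm_ell2 (x : ell2 R nat) : rnorm x = l2norm (val x).
Proof. by rewrite /rnorm norm_ell2E. Qed.

Lemma sqsum_support n m x : (forall i, (n <= i)%N -> x i = 0) ->
  sqsum m x <= sqsum n x.
Proof.
move=> x0; have [/le_sqsum//|/ltnW nm] := leqP m n.
rewrite /sqsum -!(big_mkord xpredT (fun i => rnorm (x i) ^+ 2)).
rewrite [leLHS](@big_cat_nat _ _ _ n 0 m)//= [X in _ + X]big_nat_cond.
rewrite [X in _ + X]big1 ?addr0// => i.
by rewrite andbT => /andP[ni _]; rewrite x0// rnorm0 expr0n.
Qed.

Lemma l2norm_finite n (x : nat -> C) : (forall i, (n <= i)%N -> x i = 0) ->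
  x \in @square_summable R nat /\ l2norm x = Num.sqrt (sqsum n x).
Proof.
move=> x0; have le m := sqsum_support m x0.
have xs : x \in @square_summable R nat by exact: bounded_square_summable le.
split=> //; apply/eqP; rewrite eq_le; apply/andP; split.
  by apply: l2norm_le => [|m]; rewrite ?sqrtr_ge0// sqr_sqrtr ?sqsum_ge0.
by rewrite -[leRHS]ger0_norm ?l2norm_ge0// -sqrtr_sqr ler_wsqrtr// sqsum_le_l2norm.
Qed.

Lemma unit_support n a : (forall i, (n <= i)%N -> a i = 0) -> sqsum n a <= 1 ->
  a \in @square_summable R nat /\ l2norm a <= 1.
Proof.
move=> a0 a1; have h m : sqsum m a <= 1 ^+ 2.
  by rewrite expr1n (le_trans (sqsum_support _ a0)).
by split; [exact: bounded_square_summable h | exact: l2norm_le h].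
Qed.

(** The bilinear form of Cauchy-Schwarz, with bounds [p] and [q] on the norms:
    this is how it is applied to truncations of infinite sequences. *)
Lemma cauchy_schwarz_sum n a x p q : 0 <= p -> 0 <= q ->
  sqsum n a <= p ^+ 2 -> sqsum n x <= q ^+ 2 ->
  rnorm (\sum_(i < n) a i * x i) <= p * q.
Proof.
move=> p0 q0 ap xq; apply: le_trans (rnorm_sum _ _ _) _.
suff h : \sum_(i < n) rnorm (a i * x i) <=
    Num.sqrt (sqsum n a) * Num.sqrt (sqsum n x).
  apply: le_trans h _; rewrite ler_pM ?sqrtr_ge0//.
    by rewrite -(sqr_sqrtr p0) expr2 -sqrtrM// -expr2 ler_wsqrtr.
  by rewrite -(sqr_sqrtr q0) expr2 -sqrtrM// -expr2 ler_wsqrtr.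
elim: n {ap xq} => [|n IH]; first by rewrite big_ord0 mulr_ge0 ?sqrtr_ge0.
rewrite /sqsum !big_ord_recr/= -!/(sqsum _ _).
move: IH; rewrite -{2}(sqr_sqrtr (sqsum_ge0 n a)) -{2}(sqr_sqrtr (sqsum_ge0 n x)).
move: (sqrtr_ge0 (sqsum n a)) (sqrtr_ge0 (sqsum n x)).
set P := Num.sqrt (sqsum n a); set Q := Num.sqrt (sqsum n x) => P0 Q0 IH.
have a0 := rnorm_ge0 (a n); have x0 := rnorm_ge0 (x n).
apply: (@le_trans _ _ (P * Q + rnorm (a n) * rnorm (x n))).
  by rewrite rnormM lerD2r.
rewrite -sqrtrM ?addr_ge0 ?sqr_ge0// -[leLHS]ger0_norm ?addr_ge0 ?mulr_ge0//.
rewrite -sqrtr_sqr ler_wsqrtr//.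
by have := sqr_ge0 (P * rnorm (x n) - Q * rnorm (a n)); nra.
Qed.

(** The test vector for the first [n] coordinates is their normalised
    conjugate.  Finite support lets one bound the norm of a sequence that is
    not yet known to be square-summable. *)
Lemma l2norm_dual x B : 0 <= B ->
  (forall n a, (forall i, (n <= i)%N -> a i = 0) -> sqsum n a <= 1 ->
     rnorm (\sum_(i < n) a i * x i) <= B) ->
  x \in @square_summable R nat /\ l2norm x <= B.
Proof.
move=> B0 xB; suff h n : sqsum n x <= B ^+ 2.
  by split; [exact: bounded_square_summable h | exact: l2norm_le].
set s := Num.sqrt (sqsum n x); have s0 : 0 <= s by exact: sqrtr_ge0.
have sE : sqsum n x = s ^+ 2 by rewrite sqr_sqrtr ?sqsum_ge0.
rewrite sE lerXn2r ?nnegrE//; have [->//|sn0] := eqVneq s 0.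
have sp : 0 < s by rewrite lt_neqAle eq_sym sn0.
pose a i := if (i < n)%N then ((s^-1)%:C)%C * (x i)^* else 0.
have aE (i : 'I_n) : a i = ((s^-1)%:C)%C * (x i)^* by rewrite /a ltn_ord.
have := xB n a; rewrite {1}/sqsum.
under eq_bigr do rewrite aE rnormM rnorm_conj rnorm_real exprMn.
rewrite -mulr_sumr -/(sqsum n x) sE real_normK ?num_real// -exprMn mulVf// expr1n.
under eq_bigr do rewrite aE -mulrA [_^* * _]mulrC mul_conj.
rewrite -mulr_sumr -rmorph_sum -/(sqsum n x) sE -rmorphM/= rnorm_real.
rewrite expr2 mulrA mulVf// mul1r ger0_norm//; apply=> // i ni.
by rewrite /a ltnNge ni.
Qed.

End SquareSums.

(** * The capped logarithm *)

Section Profiles.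
Context {R : realType}.
Implicit Types s t e : R.

(** The logarithm makes [s * caplog k e s] vary slowly; the cap [k] keeps the
    resulting twisted sum isomorphic to a direct sum at each fixed level.  It
    decreases from [k] near 0 to [0] at 1, while [ln 0 = 0] makes it [0] at 0. *)
Definition caplog (k : nat) e s : R := Num.min k%:R (- (e * ln s)).

Lemma mul_ln_ratio_le s t : 0 < s -> s <= t -> s * t * (ln t - ln s) <= t ^+ 2.
Proof.
move=> s0 st; have t0 : 0 < t by exact: lt_le_trans st.
rewrite -ln_div ?posrE//.
have h : ln (t / s) <= t / s - 1.
  have := @le_ln1Dx R (t / s - 1); rewrite [1 + _]addrC subrK; apply.
  by rewrite ltrBrDr addNr divr_gt0.
apply: le_trans (ler_wpM2l _ h) _; first by rewrite mulr_ge0 ?ltW.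
have -> : s * t * (t / s - 1) = t ^+ 2 - s * t.
  by field; rewrite gt_eqF.
by rewrite gerBl mulr_ge0 ?ltW.
Qed.

(** Capping is a contraction, so only the logarithm matters; for [s <= t] the
    factor [s * t] turns [ln (t / s) <= t / s] into a bound by [t ^+ 2]. *)
Lemma caplog_lipschitz k e s t : 0 <= e -> 0 <= s -> 0 <= t ->
  s * t * `|caplog k e s - caplog k e t| <= e * (s ^+ 2 + t ^+ 2).
Proof.
move=> e0.
wlog st : s t / s <= t.
  move=> h s0 t0; have [st|/ltW ts] := lerP s t; first exact: h.
  by rewrite [s * t]mulrC [s ^+ 2 + _]addrC distrC; exact: h.
rewrite le_eqVlt => /predU1P[<- t0|s0 t0].
  by rewrite !mul0r mulr_ge0// addr_ge0 ?sqr_ge0.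
have t1 : 0 < t by exact: lt_le_trans st.
have h : `|caplog k e s - caplog k e t| <= e * (ln t - ln s).
  have le : e * ln s <= e * ln t by rewrite ler_wpM2l// ler_ln.
  rewrite mulrBr /caplog; rewrite !minEle; do 2 case: ifPn => /=; rewrite -?ltNge => *;
    rewrite ler_norml; apply/andP; split; lra.
apply: (@le_trans _ _ (s * t * (e * (ln t - ln s)))).
  by rewrite ler_wpM2l// mulr_ge0// ltW.
rewrite mulrCA ler_wpM2l//; apply: le_trans (mul_ln_ratio_le s0 st) _.
by rewrite lerDr sqr_ge0.
Qed.

Lemma caplog_bounds k e s : 0 <= e -> 0 <= s <= 1 -> 0 <= caplog k e s <= k%:R.
Proof.
move=> e0 /andP[s0 s1]; rewrite /caplog ge_min lexx/= andbT le_min ler0n/=.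
by rewrite oppr_ge0 mulr_ge0_le0// ln_le0.
Qed.

(** The bound does not depend on the cap, because [- s * ln s] is at most 1 on
    the unit interval; so a unit vector that lives in one group keeps norm at
    most 1 in the twisted sum, whatever its level. *)
Lemma caplog_small k (e s : R) : 0 <= e <= 1 -> 0 <= s <= 1 -> `|s * caplog k e s| <= 1.
Proof.
move=> /andP[e0 e1] s01; have /andP[s0 s1] := s01.
have /andP[c0 _] := caplog_bounds k e0 s01.
rewrite ger0_norm ?mulr_ge0//; move: s0; rewrite le_eqVlt => /predU1P[<-|s0].
  by rewrite mul0r ler01.
have := mul_ln_ratio_le s0 s1; rewrite ln1 sub0r mulr1 expr1n => h.
apply: (@le_trans _ _ (s * - (e * ln s))).
  by rewrite ler_wpM2l ?(ltW s0)// /caplog ge_min lexx orbT.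
by rewrite -mulrN mulrCA; apply: le_trans (ler_wpM2l e0 h) _; rewrite mulr1.
Qed.

(** The cap is reached at [1 / sqrt m] once [sqrt m] exceeds [expR (k / e)]. *)
Lemma caplog_cap k (e : R) : 0 < e -> exists2 m : nat, (0 < m)%N &
  caplog k e (Num.sqrt m%:R)^-1 = k%:R.
Proof.
move=> e0; pose A : R := expR (k%:R / e); exists (Num.truncn (A ^+ 2)).+1 => //.
set m := _.+1; have Am : A ^+ 2 <= m%:R by rewrite ltW// truncnS_gt.
have As : A <= Num.sqrt m%:R.
  by rewrite -[leLHS]ger0_norm ?expR_ge0// -sqrtr_sqr ler_wsqrtr.
have s0 : 0 < Num.sqrt m%:R :> R by rewrite sqrtr_gt0 ltr0n.
have lnA : k%:R / e <= ln (Num.sqrt m%:R).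
  by rewrite -[leLHS]expRK ler_ln ?posrE ?expR_gt0.
rewrite /caplog lnV ?posrE// mulrN opprK; apply/min_idPl.
by rewrite mulrC -ler_pdivrMr.
Qed.

End Profiles.

(** * The nonlinear map and its almost symmetry *)

Section Groups.
Context {R : realType}.
Local Notation C := R[i].
Variable (group : nat -> nat).
Implicit Types (a x y : nat -> C) (g n : nat).

Definition mask g x : nat -> C := fun i => if group i == g then x i else 0.

Lemma mask_summable g x : x \in @square_summable R nat ->
  mask g x \in @square_summable R nat /\ l2norm (mask g x) <= l2norm x.
Proof.
move=> xs; apply: le_l2norm => // i; rewrite /mask; case: ifP => // _.
by rewrite rnorm0 rnorm_ge0.
Qed.

(** The groups partition the coordinates, hence finitely many of them carry at
    most the whole square norm. *)
Lemma sum_mask_sqnorm K x : x \in @square_summable R nat ->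
  \sum_(g < K) l2norm (mask g x) ^+ 2 <= l2norm x ^+ 2.
Proof.
move=> xs; rewrite -lee_fin -sumEFin -sqnormE//.
under eq_bigr do rewrite -sqnormE ?(mask_summable _ xs).1//.
rewrite /ell2_sqnorm -esum_sum; last by move=> i g _ _; rewrite lee_fin sqr_ge0.
apply: le_esum => i _; rewrite sumEFin lee_fin.
have [giK|Kgi] := ltnP (group i) K.
  rewrite (bigD1 (Ordinal giK))//= {1}/mask eqxx big1 ?addr0// => g gi.
  rewrite /mask ifN ?rnorm0 ?expr0n//; apply: contra gi => /eqP gi.
  exact/eqP/val_inj.
rewrite big1 ?sqr_ge0// => g _; rewrite /mask ifN ?rnorm0 ?expr0n//.
by apply: contraTneq Kgi => ->; rewrite -ltnNge.
Qed.

Lemma sum_by_group (n : nat) (F : nat -> C) : exists K,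
  \sum_(i < n) F i = \sum_(g < K) \sum_(i < n) (if group i == g then F i else 0).
Proof.
pose K := (\max_(i < n) group i).+1; exists K.
rewrite exchange_big/=; apply: eq_bigr => i _.
have giK : (group i < K)%N by rewrite ltnS (leq_bigmax (F := fun i : 'I_n => group i)).
rewrite (bigD1 (Ordinal giK))//= eqxx big1 ?addr0// => g gi.
by rewrite ifN//; apply: contra gi => /eqP gi; exact/eqP/val_inj.
Qed.

Variable (f : nat -> R -> R).

(** [fun i => weight a i * a i] is the nonlinear map [Phi]. *)
Definition weight a i : R := f (group i) (l2norm (mask (group i) a)).

(** Within a group the two weights are constants, so that Cauchy-Schwarz leaves
    [p * q * `|f g q - f g p|], where [p] and [q] are the norms of the parts of
    [x] and [a]; the Lipschitz inequality bounds this by a quantity whose sum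
    over the groups is at most [2 * e].  Only the groups met by [x] count,
    since the others contribute nothing. *)
Lemma weight_almost_symmetric (lip : nat -> R) (e : R) n a x :
  (forall g s t, 0 <= s -> 0 <= t ->
     s * t * `|f g s - f g t| <= lip g * (s ^+ 2 + t ^+ 2)) ->
  0 <= e -> (forall i, x i != 0 -> lip (group i) <= e) ->
  (forall i, (n <= i)%N -> a i = 0) -> sqsum n a <= 1 ->
  x \in @square_summable R nat -> l2norm x <= 1 ->
  rnorm (\sum_(i < n) a i * (((weight a i - weight x i)%:C)%C * x i)) <= 2 * e.
Proof.
move=> flip e0 xe a0 a1 xs x1; have [as_ al1] := unit_support a0 a1.
have [K ->] := sum_by_group n (fun i => a i * (((weight a i - weight x i)%:C)%C * x i)).
apply: le_trans (rnorm_sum _ _ _) _.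
apply: (@le_trans _ _ (\sum_(g < K) (e * (l2norm (mask g a) ^+ 2 + l2norm (mask g x) ^+ 2)))).
  apply: ler_sum => g _.
  set q := l2norm (mask g a); set p := l2norm (mask g x).
  have p0 : 0 <= p by exact: l2norm_ge0.
  have q0 : 0 <= q by exact: l2norm_ge0.
  have rhs0 : 0 <= e * (q ^+ 2 + p ^+ 2) by rewrite mulr_ge0// addr_ge0 ?sqr_ge0.
  have -> : \sum_(i < n) (if group i == g
      then a i * (((weight a i - weight x i)%:C)%C * x i) else 0) =
      ((f g q - f g p)%:C)%C * \sum_(i < n) mask g a i * mask g x i.
    rewrite mulr_sumr; apply: eq_bigr => i _; rewrite /mask; case: eqP => [gi|_].
      by rewrite /weight gi mulrCA.
    by rewrite !mulr0.
  have [x0|[i [gi xi]]] : (forall i, mask g x i = 0) \/ exists i, group i = g /\ x i != 0.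
    have [h|h] := pselect (exists i, group i = g /\ x i != 0); [by right|left].
    move=> i; rewrite /mask; case: eqP => // gi; apply/eqP; apply: contra_notT h => xi.
    by exists i.
  - by rewrite big1 ?mulr0 ?rnorm0// => i _; rewrite x0 mulr0.
  - have lge : lip g <= e by rewrite -gi xe.
    rewrite rnormM rnorm_real.
    apply: (@le_trans _ _ (`|f g q - f g p| * (q * p))).
      rewrite ler_wpM2l// cauchy_schwarz_sum//; apply: sqsum_le_l2norm.
        exact: (mask_summable g as_).1.
      exact: (mask_summable g xs).1.
    rewrite mulrC; apply: le_trans (flip _ _ _ q0 p0) _.
    by rewrite ler_wpM2r// addr_ge0 ?sqr_ge0.
rewrite -mulr_sumr mulrC ler_wpM2r// big_split/=.
rewrite (_ : 2 = 1 + 1)// lerD// (le_trans (sum_mask_sqnorm _ _))//;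
by rewrite -(expr1n _ 2) lerXn2r ?nnegrE ?l2norm_ge0.
Qed.

Lemma weight_bounded_sum (M : R) n a x : 0 <= M ->
  (forall i s, x i != 0 -> 0 <= s <= 1 -> `|f (group i) s| <= M) ->
  (forall i, (n <= i)%N -> a i = 0) -> sqsum n a <= 1 ->
  x \in @square_summable R nat ->
  rnorm (\sum_(i < n) a i * (((weight a i)%:C)%C * x i)) <= M * l2norm x.
Proof.
move=> M0 fM a0 a1 xs; have [as_ al1] := unit_support a0 a1.
rewrite -[leRHS]mul1r.
apply: (@cauchy_schwarz_sum _ n a (fun i => ((weight a i)%:C)%C * x i));
  rewrite ?expr1n ?mulr_ge0 ?l2norm_ge0//.
apply: (@le_trans _ _ (M ^+ 2 * sqsum n x)); last first.
  by rewrite exprMn ler_wpM2l ?sqr_ge0// sqsum_le_l2norm.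
rewrite mulr_sumr; apply: ler_sum => i _; rewrite -exprMn lerXn2r ?nnegrE ?mulr_ge0 ?rnorm_ge0//.
rewrite rnormM rnorm_real; have [->|xi] := eqVneq (x i) 0; first by rewrite rnorm0 !mulr0.
rewrite ler_wpM2r ?rnorm_ge0// fM// l2norm_ge0/=.
by apply: le_trans al1; case: (mask_summable (group i) as_).
Qed.

End Groups.

(** * The twisted sum *)

Section TwistedSum.
Context {R : realType}.
Local Notation C := R[i].
Variables (group : nat -> nat) (f : nat -> R -> R).
Implicit Types (a : nat -> C) (n : nat) (z : ((nat -> C) * (nat -> C))%type).

(** The functionals that define the norm: [<y, a> + <x, Phi a>] for
    [twist = true], and [<x, a>] otherwise.  No conjugate is taken, so that they
    are linear in [z = (y, x)]. *)
Definition pairing (twist : bool) n a z : C :=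
  \sum_(i < n) a i *
    (if twist then z.1 i + ((weight group f a i)%:C)%C * z.2 i else z.2 i).

Lemma pairingD t n a : {morph pairing t n a : z z' / z + z'}.
Proof.
move=> z z'; rewrite /pairing -big_split; apply: eq_bigr => i _ /=.
by rewrite -mulrDr; congr (_ * _); case: t => //; rewrite mulrDr addrACA.
Qed.

Lemma pairingZ t n a (c : C) z : pairing t n a (c *: z) = c * pairing t n a z.
Proof.
rewrite /pairing mulr_sumr; apply: eq_bigr => i _ /=.
by rewrite [RHS]mulrCA; congr (_ * _); case: t => //; rewrite mulrDr [in RHS]mulrCA.
Qed.

Lemma pairing0 t n a : pairing t n a 0 = 0.
Proof. by rewrite -(scale0r 0) pairingZ mul0r. Qed.

Lemma pairingB t n a z z' : pairing t n a (z - z') = pairing t n a z - pairing t n a z'.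
Proof. by rewrite -scaleN1r pairingD pairingZ mulN1r. Qed.

Definition dual_bounded (B : R) z := forall t n a,
  (forall i, (n <= i)%N -> a i = 0) -> sqsum n a <= 1 ->
  rnorm (pairing t n a z) <= B.

Definition dually_bounded : {pred ((nat -> C) * (nat -> C))%type} :=
  fun z => `[< exists B, dual_bounded B z >].

Definition twisted : Type :=
  {z : ((nat -> C) * (nat -> C))%type | z \in dually_bounded}.

Lemma dually_bounded_submod : submod_closed dually_bounded.
Proof.
split=> [|c z z' /asboolP[B zB] /asboolP[B' zB']]; apply/asboolP.
  by exists 0 => t n a _ _; rewrite pairing0 rnorm0.
exists (rnorm c * B + B') => t n a a0 a1; rewrite pairingD pairingZ.
rewrite (le_trans (rnormD _ _))// lerD//; last exact: zB'.
by rewrite rnormM ler_wpM2l ?rnorm_ge0// zB.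
Qed.

HB.instance Definition _ :=
  GRing.isSubmodClosed.Build C ((nat -> C) * (nat -> C))%type dually_bounded
    dually_bounded_submod.

HB.instance Definition _ := SubChoice.on twisted.
HB.instance Definition _ := [SubChoice_isSubLmodule of twisted by <:].

Definition dual_values z : set R :=
  [set r | exists t n a, [/\ forall i, (n <= i)%N -> a i = 0, sqsum n a <= 1
     & r = rnorm (pairing t n a z)]].

Definition dual_norm z : R := sup (dual_values z).

Lemma dual_values_nonempty z : dual_values z !=set0.
Proof.
exists 0; exists false, 0, (fun=> 0); split=> //; first by rewrite /sqsum big_ord0.
by rewrite /pairing big_ord0 rnorm0.
Qed.

Lemma dual_norm_le z B : dual_bounded B z -> dual_norm z <= B.
Proof.
move=> zB; apply: ge_sup; first exact: dual_values_nonempty.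
by move=> _ [t [n [a [a0 a1 ->]]]]; exact: zB.
Qed.

Lemma dual_norm_bounded (z : twisted) : dual_bounded (dual_norm (val z)) (val z).
Proof.
move=> t n a a0 a1; apply: ub_le_sup; last by exists t, n, a.
have /asboolP[B zB] := valP z.
by exists B => _ [t' [n' [a' [? ? ->]]]]; exact: zB.
Qed.

Lemma dual_norm_ge0 (z : twisted) : 0 <= dual_norm (val z).
Proof.
apply: le_trans (@dual_norm_bounded z false 0 (fun=> 0) _ _) => //.
  exact: rnorm_ge0.
by rewrite /sqsum big_ord0.
Qed.

Definition unit_vector (i : nat) : nat -> C := fun j => if j == i then 1 else 0.

Lemma sum_unit_vector i (F : nat -> C) :
  \sum_(j < i.+1) unit_vector i j * F j = F i.
Proof.
rewrite big_ord_recr/= /unit_vector eqxx mul1r big1 ?add0r// => j _.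
by rewrite ltn_eqF ?mul0r.
Qed.

Lemma unit_vector_support i j : (i < j)%N -> unit_vector i j = 0.
Proof. by move=> ij; rewrite /unit_vector gtn_eqF. Qed.

Lemma sqsum_unit_vector i n : sqsum n (unit_vector i) <= 1.
Proof.
apply: le_trans (sqsum_support n (@unit_vector_support i)) _.
rewrite /sqsum big_ord_recr/= /unit_vector eqxx rnorm1 expr1n big1 ?add0r// => j _.
by rewrite ltn_eqF ?rnorm0 ?expr0n.
Qed.

Lemma coord2_pairing z i : z.2 i = pairing false i.+1 (unit_vector i) z.
Proof. by rewrite /pairing sum_unit_vector. Qed.

(** Coordinates are combinations of two functionals: hence the norm separates
    points, and Cauchy filters converge coordinatewise. *)
Lemma coord1_pairing z i : z.1 i = pairing true i.+1 (unit_vector i) z -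
  ((weight group f (unit_vector i) i)%:C)%C * pairing false i.+1 (unit_vector i) z.
Proof.
rewrite /pairing (sum_unit_vector i z.2).
rewrite (sum_unit_vector i (fun j =>
  z.1 j + ((weight group f (unit_vector i) j)%:C)%C * z.2 j)).
by rewrite addrK.
Qed.

Lemma dual_bounded0 z : dual_bounded 0 z -> z = 0.
Proof.
move=> z0; have p0 t i : pairing t i.+1 (unit_vector i) z = 0.
  apply: rnorm_eq0; apply/eqP; rewrite eq_le rnorm_ge0 andbT z0 ?sqsum_unit_vector//.
  exact: unit_vector_support.
have e1 i : z.1 i = 0 by rewrite coord1_pairing !p0 mulr0 subr0.
have e2 i : z.2 i = 0 by rewrite coord2_pairing p0.
by case: z e1 e2 {z0 p0} => y x/= e1 e2; congr pair; apply/funext.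
Qed.

Definition twisted_norm (z : twisted) : C := ((dual_norm (val z))%:C)%C.

Let nrmD (z z' : twisted) : twisted_norm (z + z') <= twisted_norm z + twisted_norm z'.
Proof.
rewrite /twisted_norm -rmorphD /= lecR; apply: dual_norm_le => t n a a0 a1.
rewrite pairingD (le_trans (rnormD _ _))// lerD//; exact: dual_norm_bounded.
Qed.

Let nrmZ_le (c : C) (z : twisted) :
  dual_norm (val (c *: z)) <= rnorm c * dual_norm (val z).
Proof.
apply: dual_norm_le => t n a a0 a1; rewrite pairingZ rnormM.
by rewrite ler_wpM2l ?rnorm_ge0//; exact: dual_norm_bounded.
Qed.

Let nrmZ (c : C) (z : twisted) : twisted_norm (c *: z) = `|c| * twisted_norm z.
Proof.
rewrite (rnormE c) /twisted_norm -rmorphM; congr (_%:C)%C.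
apply/eqP; rewrite eq_le nrmZ_le andTb.
have [->|c0] := eqVneq c 0.
  by rewrite rnorm0 mul0r; exact: dual_norm_ge0.
have rc0 : 0 < rnorm c.
  by rewrite lt_neqAle rnorm_ge0 andbT eq_sym; apply: contra c0 => /eqP/rnorm_eq0->.
rewrite -ler_pdivlMl//.
have := nrmZ_le c^-1 (c *: z); rewrite scalerA mulVf// scale1r.
by rewrite /rnorm normfV (rnormE c) -fmorphV.
Qed.

Let nrm0 (z : twisted) : twisted_norm z = 0 -> z = 0.
Proof.
move=> /(@complexI R) z0; apply: val_inj; apply: dual_bounded0 => t n a a0 a1.
by rewrite -z0; exact: dual_norm_bounded.
Qed.

HB.instance Definition _ := Lmodule_isNormed.Build C twisted nrmD nrmZ nrm0.

Lemma rnorm_twisted_le (z : twisted) B : dual_bounded B (val z) -> rnorm z <= B.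
Proof. exact: dual_norm_le. Qed.

Lemma pairing_le (z : twisted) : dual_bounded (rnorm z) (val z).
Proof. exact: dual_norm_bounded. Qed.

End TwistedSum.

(** * Completeness *)

Section Completeness.
Context {R : realType}.
Local Notation C := R[i].

Lemma pos_complexE (e : C) : 0 < e -> exists2 r : R, 0 < r & e = (r%:C)%C.
Proof.
move=> e0; have eE : e = ((complex.Re e)%:C)%C by rewrite RRe_real ?gtr0_real.
by exists (complex.Re e) => //; move: e0; rewrite {1}eE ltcR.
Qed.

Lemma ball_rnorm (V : normedModType C) (x y : V) (r : R) :
  ball x (r%:C)%C y <-> rnorm (x - y) < r.
Proof. by rewrite -ball_normE /ball_/= rnormE ltcR. Qed.

Lemma cauchy_rnorm (V : normedModType C) (F : set_system V) : ProperFilter F ->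
  cauchy F -> forall r : R, 0 < r -> exists x, F [set y | rnorm (x - y) < r].
Proof.
move=> FF /cauchyP/(_ _) cF r r0.
have rC : 0 < (r%:C)%C :> C by rewrite ltcR.
have [x Fx] := cF _ rC; exists x.
by apply: filterS Fx => y /ball_rnorm.
Qed.

Lemma rnorm_ge_parts (u : C) :
  `|complex.Re u| <= rnorm u /\ `|complex.Im u| <= rnorm u.
Proof.
rewrite /rnorm normc_def /= -(sqrtr_sqr (complex.Re u)) -(sqrtr_sqr (complex.Im u)).
by split; rewrite ler_wsqrtr// ?lerDl ?lerDr sqr_ge0.
Qed.

Lemma rnorm_le_parts (u : C) : rnorm u <= `|complex.Re u| + `|complex.Im u|.
Proof.
rewrite /rnorm normc_def /= -(@ler_pXn2r _ 2) ?nnegrE ?addr_ge0 ?sqrtr_ge0//.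
rewrite sqr_sqrtr ?addr_ge0 ?sqr_ge0// sqrrD !real_normK ?num_real//.
by rewrite addrAC lerDl mulrn_wge0 ?mulr_ge0.
Qed.

(** Completeness of the reals, read through a 1-Lipschitz functional. *)
Lemma real_functional_cvg (V : normedModType C) (F : set_system V) (p : V -> R) :
  ProperFilter F -> cauchy F -> (forall x y, `|p x - p y| <= rnorm (x - y)) ->
  exists l : R, forall r : R, 0 < r -> F [set x | `|p x - l| < r].
Proof.
move=> FF cF pL; have : cvg (p @ F).
  apply: cauchy_cvg; apply/cauchyP => e e0.
  have [x Fx] := cauchy_rnorm FF cF e0; exists (p x).
  rewrite /nbhs/=; apply: filterS Fx => y /= xy.
  by rewrite -ball_normE /ball_/= (le_lt_trans (pL _ _)).
move=> /cvg_ex[l /cvgrPdist_lt pl]; exists l => r r0.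
by have := pl _ r0; apply: filterS => x /=; rewrite distrC.
Qed.

Lemma functional_cvg (V : normedModType C) (F : set_system V) (p : V -> C) :
  ProperFilter F -> cauchy F -> (forall x y, rnorm (p x - p y) <= rnorm (x - y)) ->
  exists l : C, forall r : R, 0 < r -> F [set x | rnorm (p x - l) < r].
Proof.
move=> FF cF pL.
have [x y|l1 pl1] := real_functional_cvg (p := fun x => complex.Re (p x)) FF cF.
  by rewrite -raddfB; apply: le_trans (pL x y); case: (rnorm_ge_parts (p x - p y)).
have [x y|l2 pl2] := real_functional_cvg (p := fun x => complex.Im (p x)) FF cF.
  by rewrite -raddfB; apply: le_trans (pL x y); case: (rnorm_ge_parts (p x - p y)).
exists (l1 +i* l2)%C => r r0; have r2 : 0 < r / 2 by rewrite divr_gt0.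
apply: filterS2 (pl1 _ r2) (pl2 _ r2) => x /= h1 h2.
apply: le_lt_trans (rnorm_le_parts _) _; rewrite [r]splitr ltrD//.
  by case: (p x) h1.
by case: (p x) h2.
Qed.

Section TwistedComplete.
Variables (group : nat -> nat) (f : nat -> R -> R).
Local Notation Z := (twisted group f).

(** A functional reads finitely many coordinates, so coordinatewise convergence
    suffices for it. *)
Lemma pairing_cvg_sum (F : set_system Z) (w : (nat -> C) * (nat -> C)) : ProperFilter F ->
  (forall i r, 0 < r -> F [set z : Z | rnorm ((val z).1 i - w.1 i) < r]) ->
  (forall i r, 0 < r -> F [set z : Z | rnorm ((val z).2 i - w.2 i) < r]) ->
  forall t n a r, 0 < r ->
    F [set z : Z | rnorm (pairing group f t n a (val z - w)) < r].
Proof.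
move=> FF F1 F2 t n a r r0.
pose B (i : 'I_n) : R := rnorm (a i) * (1 + rnorm (((weight group f a i)%:C)%C : C)).
have B0 i : 0 <= B i by rewrite mulr_ge0 ?addr_ge0 ?rnorm_ge0.
pose s := r / (1 + \sum_i B i).
have d0 : 0 < 1 + \sum_i B i by rewrite ltr_pwDl// sumr_ge0.
have s0 : 0 < s by rewrite divr_gt0.
have FF' : Filter F by exact: filter_filter.
have : F [set z : Z | forall i : 'I_n,
    rnorm ((val z).1 i - w.1 i) < s /\ rnorm ((val z).2 i - w.2 i) < s].
  pose P (i : 'I_n) : set Z := [set z : Z |
    rnorm ((val z).1 i - w.1 i) < s /\ rnorm ((val z).2 i - w.2 i) < s].
  have h (i : 'I_n) : F (P i) by exact: filterI (F1 i _ s0) (F2 i _ s0).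
  exact (@filter_forall Z 'I_n P F FF' h).
apply: filterS => z /= zs; apply: (@le_lt_trans _ _ (\sum_i B i * s)).
  apply: le_trans (rnorm_sum _ _ _) _; apply: ler_sum => i _.
  have [/= z1 z2] := zs i.
  rewrite rnormM /B -mulrA ler_wpM2l ?rnorm_ge0//.
  case: t => /=; last first.
    by rewrite (le_trans (ltW z2))// ler_peMl ?(ltW s0)// lerDl rnorm_ge0.
  rewrite mulrDl mul1r (le_trans (rnormD _ _))// lerD ?(ltW z1)//.
  by rewrite rnormM ler_wpM2l ?rnorm_ge0// ltW.
rewrite -mulr_suml /s mulrCA gtr_pMr// ltr_pdivrMr// mul1r.
by rewrite ltrDr.
Qed.

(** The candidate [w] is the coordinatewise limit.  The Cauchy bound on each
    functional passes to the limit, uniformly in the functional, which at the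
    same time shows that [w] belongs to the space. *)
Lemma twisted_cauchy_cvg (F : set_system Z) : ProperFilter F -> cauchy F -> cvg F.
Proof.
move=> FF cF.
have ex_l t i : exists l : C, forall r : R, 0 < r ->
    F [set z : Z | rnorm (pairing group f t i.+1 (unit_vector i) (val z) - l) < r].
  apply: functional_cvg => // z z'; rewrite -pairingB.
  apply: (pairing_le (z - z')); last exact: sqsum_unit_vector.
  exact: unit_vector_support.
pose l t i : C := sval (cid (ex_l t i)).
have pl t i r : 0 < r ->
    F [set z : Z | rnorm (pairing group f t i.+1 (unit_vector i) (val z) - l t i) < r].
  by rewrite /l; case: cid => // l' h; exact: h.
pose c i : C := ((weight group f (unit_vector i) i)%:C)%C.
pose w : (nat -> C) * (nat -> C) := (fun i => l true i - c i * l false i, l false).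
have F2 i r : 0 < r -> F [set z : Z | rnorm ((val z).2 i - w.2 i) < r].
  by move=> r0; apply: filterS (pl false i _ r0) => z /=; rewrite -coord2_pairing.
have F1 i r : 0 < r -> F [set z : Z | rnorm ((val z).1 i - w.1 i) < r].
  move=> r0; have c0 : 0 < 1 + rnorm (c i) by rewrite ltr_pwDl ?rnorm_ge0.
  have s0 : 0 < r / (1 + rnorm (c i)) by rewrite divr_gt0.
  apply: filterS2 (pl true i _ s0) (pl false i _ s0) => z /=.
  set s := r / _ in s0 *; rewrite (coord1_pairing group f) -/(c i).
  set u := pairing _ _ _ _ _ _; set v := pairing _ _ _ _ _ _ => h1 h2.
  rewrite (_ : _ - _ = (u - l true i) - c i * (v - l false i)); last by ring.
  rewrite (le_lt_trans (rnormD _ _))// rnormN rnormM.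
  have -> : r = s + rnorm (c i) * s.
    by rewrite -[X in X + _]mul1r -mulrDl mulrC divfK// gt_eqF.
  by rewrite ltr_leD// ler_wpM2l ?rnorm_ge0// ltW.
(* For a given functional, [z'] is chosen so close to [w] that the error [e]
   is arbitrary, while [z] does not depend on the functional. *)
have close (r : R) : 0 < r ->
    F [set z : Z | dual_bounded group f r (val z - w)].
  move=> r0; have r2 : 0 < r / 2 by rewrite divr_gt0.
  have r4 : 0 < r / 2 / 2 by rewrite divr_gt0.
  have [z0 Fz0] := cauchy_rnorm FF cF r4.
  apply: filterS (Fz0) => z /= zz0 t n a a0 a1.
  apply/ler_addgt0Pr => e e0.
  have [z' [/= z'w z'z0]] := filter_ex
    (filterI (pairing_cvg_sum FF F1 F2 t n a e0) Fz0).
  have -> : val z - w = (val (z - z')) + (val z' - w).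
    by rewrite raddfB /= addrA subrK.
  rewrite pairingD (le_trans (rnormD _ _))// lerD ?(ltW z'w)//.
  apply: le_trans (pairing_le (z - z') t a0 a1) _.
  have -> : z - z' = (z0 - z') - (z0 - z) by rewrite opprB [RHS]addrC addrA subrK.
  apply: le_trans (rnormD _ _) _; rewrite rnormN.
  by move: zz0 z'z0; lra.
have [z1 /= z1w] := filter_ex (close _ ltr01).
have wZ : w \in dually_bounded group f.
  have -> : w = val z1 - (val z1 - w) by rewrite opprB addrC subrK.
  rewrite rpredB ?(valP z1)//; apply/asboolP; by exists 1.
pose w' : Z := exist _ w wZ; apply/cvg_ex; exists w'.
apply/cvgrPdist_lt => e /pos_complexE[r r0 ->].
have r2 : 0 < r / 2 by rewrite divr_gt0.
apply: filterS (close _ r2) => z zw; rewrite rnormE ltcR.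
have -> : w' - z = - (z - w') by rewrite opprB.
rewrite rnormN; apply: le_lt_trans (rnorm_twisted_le _) _.
  by rewrite raddfB; exact: zw.
by rewrite ltr_pdivrMr// ltr_pMr// ltr1n.
Qed.

HB.instance Definition _ := Uniform_isComplete.Build Z twisted_cauchy_cvg.

End TwistedComplete.
End Completeness.

(** * Bounded linear maps *)

Section BoundedLinear.
Context {R : realType}.
Local Notation C := R[i].

(** Packages a function defined inside a proof, where no instance can be
    declared, as a linear map. *)
Definition mk_linear (U V : lmodType C) (h : U -> V) (lh : linear h) :
  {linear U -> V} := HB.pack h (GRing.isLinear.Build C U V *:%R h lh).

Lemma linear_comb (U V : lmodType C) (k : {linear U -> V}) n
    (c : 'I_n -> C) (u : 'I_n -> U) :
  k (\sum_i c i *: u i) = \sum_i c i *: k (u i).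
Proof. by rewrite linear_sum; apply: eq_bigr => i _; rewrite linearZ. Qed.

Lemma bounded_continuous (U V : normedModType C) (h : {linear U -> V}) (K : R) :
  (forall x, rnorm (h x) <= K * rnorm x) -> continuous h.
Proof.
move=> hK; apply: continuousfor0_continuous; apply/cvgrPdist_lt => e /pos_complexE[r r0 ->].
have K0 : 0 < 1 + `|K| by rewrite ltr_pwDl.
have s0 : 0 < ((r / (1 + `|K|))%:C)%C :> C by rewrite ltcR divr_gt0.
rewrite linear0; near=> x; rewrite sub0r normrN rnormE ltcR.
apply: le_lt_trans (hK x) _.
have : rnorm x < r / (1 + `|K|).
  have : ball (0 : U) ((r / (1 + `|K|))%:C)%C x by near: x; exact: nbhsx_ballx.
  by move/ball_rnorm; rewrite sub0r rnormN.
rewrite ltr_pdivlMr// => xr; apply: le_lt_trans xr.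
rewrite mulrC ler_wpM2l ?rnorm_ge0// (le_trans (ler_norm K))// lerDr//.
Unshelve. all: by end_near. Qed.

Lemma opnorm_ge0 (U V : normedModType C) (h : {linear U -> V}) : (0 <= opnorm h)%E.
Proof.
apply: ereal_sup_ubound; exists 0; rewrite /= ?rnorm0 ?ler01//.
by rewrite linear0 rnorm0.
Qed.

Lemma opnorm_le (U V : normedModType C) (h : {linear U -> V}) (K : R) : 0 <= K ->
  (forall x, rnorm (h x) <= K * rnorm x) -> (opnorm h <= K%:E)%E.
Proof.
move=> K0 hK; apply: ub_ereal_sup => _ [x /= x1 <-]; rewrite lee_fin.
by rewrite (le_trans (hK x))// ler_piMr.
Qed.

Lemma isomorphism_pair_of_bounds (U V : normedModType C) (h : {linear U -> V})
    (k : {linear V -> U}) (H K : R) : cancel h k -> cancel k h ->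
  (forall x, rnorm (h x) <= H * rnorm x) -> (forall x, rnorm (k x) <= K * rnorm x) ->
  isomorphism_pair h k.
Proof. by move=> hk kh hH kK; split=> //; apply: bounded_continuous; eassumption. Qed.

End BoundedLinear.

(** * The subspace and the quotient are Hilbert spaces *)

Section TwistedHilbert.
Context {R : realType}.
Local Notation C := R[i].
Variables (group : nat -> nat) (f : nat -> R -> R).
Local Notation Z := (twisted group f).
Local Notation H := (ell2 R nat).

Lemma second_square_summable (z : Z) :
  (val z).2 \in @square_summable R nat /\ l2norm (val z).2 <= rnorm z.
Proof.
apply: l2norm_dual; first exact: rnorm_ge0.
by move=> n a a0 a1; exact: (pairing_le z false).
Qed.

Definition second (z : Z) : H := exist _ (val z).2 (second_square_summable z).1.

Lemma second_linear : linear second.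
Proof. by move=> c z z'; exact: val_inj. Qed.

HB.instance Definition _ := GRing.isLinear.Build C Z H _ second second_linear.

Lemma rnorm_second (z : Z) : rnorm (second z) <= rnorm z.
Proof. by rewrite rnorm_ell2; exact: (second_square_summable z).2. Qed.

Definition second_kernel_pred : {pred Z} := fun z => second z == 0.

Lemma second_kernel_submod : submod_closed second_kernel_pred.
Proof.
split=> [|c x y]; rewrite /in_mem /= /second_kernel_pred; first by rewrite linear0.
by move=> /eqP x0 /eqP y0; rewrite linearD linearZ /= x0 y0 scaler0 addr0.
Qed.

Definition second_kernel : lsubspace Z := LSubspace second_kernel_submod.

Lemma second_kernelP (z : Z) : z \in carrier second_kernel <-> second z = 0.
Proof. by split=> /eqP. Qed.

Lemma second_kernel_closed : closed [set z | z \in carrier second_kernel].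
Proof.
have cs : continuous second.
  by apply: (@bounded_continuous _ _ _ second 1) => z; rewrite mul1r rnorm_second.
rewrite (_ : [set z | _] = second @^-1` [set 0]).
  apply: closed_comp => [z _|]; first exact: cs.
  exact: accessible_closed_set1 (hausdorff_accessible (@norm_hausdorff _ _)) _.
by apply/seteqP; split=> z /second_kernelP.
Qed.

Lemma first_square_summable (z : Z) : second z = 0 ->
  (val z).1 \in @square_summable R nat /\ l2norm (val z).1 <= rnorm z.
Proof.
move=> /(congr1 val)/= z0; apply: l2norm_dual; first exact: rnorm_ge0.
move=> n a a0 a1; apply: le_trans (pairing_le z true a0 a1); rewrite /pairing z0.
rewrite [X in _ <= rnorm X](eq_bigr (fun i : 'I_n => a i * (val z).1 i))// => i _.
by congr (_ * _); rewrite -[RHS]addr0; congr (_ + _); exact: mulr0.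
Qed.

(** On pairs [(y, 0)] the twist disappears. *)
Lemma first_only_bound (x : nat -> C) : x \in @square_summable R nat ->
  dual_bounded group f (l2norm x) (x, 0).
Proof.
move=> xs t n a a0 a1; rewrite /pairing -[leRHS]mul1r.
case: t; last first.
  by rewrite big1 ?rnorm0 ?mulr_ge0 ?l2norm_ge0// => i _; exact: mulr0.
rewrite (eq_bigr (fun i : 'I_n => a i * x i)); last first.
  by move=> i _; congr (_ * _); rewrite -[RHS]addr0; congr (_ + _); exact: mulr0.
by apply: cauchy_schwarz_sum; rewrite ?l2norm_ge0 ?expr1n ?sqsum_le_l2norm.
Qed.

Lemma first_only_mem (x : H) : (val x, 0) \in dually_bounded group f.
Proof. by apply/asboolP; exists (l2norm (val x)); apply: first_only_bound; exact: valP. Qed.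

Definition first_only (x : H) : Z := exist _ (val x, 0) (first_only_mem x).

Lemma rnorm_first_only (x : H) : rnorm (first_only x) <= rnorm x.
Proof. by rewrite rnorm_ell2; apply: rnorm_twisted_le; apply: first_only_bound; exact: valP. Qed.

Lemma second_first_only x : first_only x \in carrier second_kernel.
Proof. by apply/second_kernelP; exact: val_inj. Qed.

Lemma second_kernel_isomorphic : isomorphic (subspace_type second_kernel) H.
Proof.
have fst_mem (z : subspace_type second_kernel) :
    second (val z) = 0 by apply/second_kernelP; exact: (valP z).
pose h (z : subspace_type second_kernel) : H :=
  exist _ (val (val z)).1 (first_square_summable (fst_mem z)).1.
pose k (x : H) : subspace_type second_kernel := exist _ (first_only x) (second_first_only x).
have lh : linear h.
  by move=> c z z'; apply: val_inj; rewrite linearP /h /=.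
have lk : linear k.
  move=> c x x'; apply: val_inj; apply: val_inj => /=; congr pair.
  by rewrite /= scaler0 addr0.
exists (mk_linear lh), (mk_linear lk); apply: (@isomorphism_pair_of_bounds _ _ _ _ _ 1 1).
- move=> z; apply: val_inj; apply: val_inj => /=.
  by have /(congr1 val)/= := fst_mem z; case: (val (val z)) => y x /= ->.
- by move=> x; apply: val_inj.
- by move=> z; rewrite mul1r rnorm_ell2; exact: (first_square_summable (fst_mem z)).2.
- by move=> x; rewrite mul1r; exact: rnorm_first_only.
Qed.

Variables (lip : nat -> R).
Hypothesis f_lip : forall g s t, 0 <= s -> 0 <= t ->
     s * t * `|f g s - f g t| <= lip g * (s ^+ 2 + t ^+ 2).
Hypothesis lip1 : forall g, lip g <= 1.

(** [- Phi x], the first component that makes [twist_bounded] work. *)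
Definition twist (x : nat -> C) : nat -> C :=
  fun i => - (((weight group f x i)%:C)%C * x i).

(** This is where almost symmetry enters: on the pair [(- Phi x, x)] the
    functional equals [<x, Phi a> - <Phi x, a>]. *)
Lemma twist_bounded (x : nat -> C) : x \in @square_summable R nat -> l2norm x <= 1 ->
  dual_bounded group f 2 (twist x, x).
Proof.
move=> xs x1 t n a a0 a1; rewrite /pairing; case: t => /=; last first.
  rewrite (le_trans (@cauchy_schwarz_sum _ n a x 1 1 _ _ _ _)) ?expr1n ?mulr1 ?ler1n//.
  apply: le_trans (sqsum_le_l2norm n xs) _; by rewrite expr_le1 ?l2norm_ge0.
have := weight_almost_symmetric f_lip ler01 (fun i (_ : x i != 0) => lip1 (group i))
  a0 a1 xs x1.
rewrite mulr1; apply: le_trans; rewrite le_eqVlt; apply/orP; left; apply/eqP; congr (rnorm _).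
by apply: eq_bigr => i _; rewrite /twist rmorphB mulrBl addrC.
Qed.

(** [twist] is not homogeneous, so a vector is first scaled to the unit
    sphere. *)
Lemma lift_exists (x : H) : exists z : Z, second z = x /\ rnorm z <= 2 * rnorm x.
Proof.
have [->|x0] := eqVneq x 0; first by exists 0; rewrite linear0 !rnorm0 mulr0.
have r0 : 0 < rnorm x.
  by rewrite lt_neqAle rnorm_ge0 andbT eq_sym; apply: contra x0 => /eqP/rnorm_eq0->.
pose c : C := ((rnorm x)%:C)%C; pose u : H := c^-1 *: x.
have c0 : c != 0 by rewrite gt_eqF ?ltcR.
have u1 : l2norm (val u) <= 1.
  rewrite -rnorm_ell2 rnormZ /c -fmorphV rnorm_real ger0_norm ?invr_ge0 ?rnorm_ge0//.
  by rewrite mulVf ?gt_eqF.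
have ub := twist_bounded (valP u) u1.
have um : (twist (val u), val u) \in dually_bounded group f by apply/asboolP; exists 2.
pose z : Z := exist _ (twist (val u), val u) um.
exists (c *: z); split.
  rewrite linearZ /= (_ : second z = u); first by rewrite scalerA divff ?scale1r.
  exact: val_inj.
rewrite rnormZ rnorm_real ger0_norm ?rnorm_ge0// mulrC ler_wpM2r ?rnorm_ge0//.
exact: rnorm_twisted_le.
Qed.

(** The lift chosen by [lift_exists] is not linear, but its class in the
    quotient is, because two lifts of a vector differ by an element of the
    kernel. *)
Lemma second_quotient_isomorphic : isomorphic (normed_quotient second_kernel_closed) H.
Proof.
pose Q := normed_quotient second_kernel_closed.
have proj_eq (z z' : Z) :
    (quotient_proj second_kernel z == quotient_proj second_kernel z') = (second z == second z').
  rewrite quotient_projE -subr_eq0 -linearB; apply/idP/eqP => /second_kernelP//.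
pose h (q : Q) : H := second (repr (q : quotient_space second_kernel)).
have hE z : h (quotient_proj second_kernel z) = second z.
  by apply/eqP; rewrite -proj_eq quotient_projK.
pose s (x : H) : Z := sval (cid (lift_exists x)).
have [sE sN] : (forall x, second (s x) = x) /\ (forall x, rnorm (s x) <= 2 * rnorm x).
  by split=> x; rewrite /s; case: cid => z [].
pose k (x : H) : Q := quotient_proj second_kernel (s x).
have lh : linear h.
  move=> c p q; rewrite -(quotient_projK (p : quotient_space second_kernel)).
  rewrite -(quotient_projK (q : quotient_space second_kernel)).
  have -> : c *: quotient_proj second_kernel (repr p) +
      quotient_proj second_kernel (repr q) =
      quotient_proj second_kernel (c *: repr p + repr q) by rewrite linearP.
  by rewrite !hE linearD linearZ.
have lk : linear k.
  move=> c x y; apply/eqP; rewrite /k.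
  have -> : c *: (quotient_proj second_kernel (s x) : Q) +
      (quotient_proj second_kernel (s y) : Q) =
      quotient_proj second_kernel (c *: s x + s y) by rewrite linearP.
  by rewrite proj_eq linearD linearZ /= !sE.
exists (mk_linear lh), (mk_linear lk); apply: (@isomorphism_pair_of_bounds _ _ _ _ _ 1 2).
- move=> q /=; rewrite -{2}(quotient_projK (q : quotient_space second_kernel)).
  by apply/eqP; rewrite /k proj_eq sE.
- by move=> x /=; rewrite /k hE sE.
- move=> q; rewrite mul1r {2}/rnorm norm_quotientE /=; apply: lb_le_inf.
    exists (rnorm (repr (q : quotient_space second_kernel))).
    by exists (repr (q : quotient_space second_kernel)); rewrite //= quotient_projK.
  by move=> _ [z /= <- <-]; rewrite hE rnorm_second.
- move=> x; apply: le_trans (sN x); rewrite {1}/rnorm norm_quotientE /=.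
  by apply: ge_inf; [exists 0 => _ [z _ <-]; exact: rnorm_ge0 | exists (s x)].
Qed.

Lemma twisted_hilbert_twisted : twisted_hilbert Z.
Proof.
exists second_kernel, second_kernel_closed.
split; [exact: second_kernel_isomorphic | exact: second_quotient_isomorphic].
Qed.

End TwistedHilbert.

(** * Inner products and Gram-Schmidt *)

Section HermitianForms.
Context {R : realType}.
Local Notation C := R[i].

Lemma conj_real (r : R) : ((r%:C)%C : C)^* = (r%:C)%C.
Proof. exact: conjc_real. Qed.

(** [h] is linear in its first argument, and [q] is the norm that it induces;
    carrying [q] along as a real-valued function avoids square roots of complex
    numbers. *)
Record inner_product (V : lmodType C) (h : V -> V -> C) (q : V -> R) : Prop := {
  ip_linear : forall c u v w, h (c *: u + v) w = c * h u w + h v w;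
  ip_conj : forall u v, h v u = (h u v)^*;
  ip_norm : forall u, h u u = ((q u ^+ 2)%:C)%C;
  ip_norm_ge0 : forall u, 0 <= q u;
  ip_definite : forall u, q u = 0 -> u = 0 }.

Section Theory.
Variables (V : lmodType C) (h : V -> V -> C) (q : V -> R).
Hypothesis hq : inner_product h q.

Lemma ip0l w : h 0 w = 0.
Proof.
have := ip_linear hq 1 0 0 w; rewrite scaler0 addr0 mul1r => /eqP.
by rewrite -subr_eq subrr eq_sym => /eqP.
Qed.

Lemma ipDl u v w : h (u + v) w = h u w + h v w.
Proof. by have := ip_linear hq 1 u v w; rewrite scale1r mul1r. Qed.

Lemma ipZl c u w : h (c *: u) w = c * h u w.
Proof. by have := ip_linear hq c u 0 w; rewrite addr0 ip0l addr0. Qed.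

Lemma ip_suml n (u : 'I_n -> V) (c : 'I_n -> C) w :
  h (\sum_i c i *: u i) w = \sum_i c i * h (u i) w.
Proof.
elim/big_ind2: _ => [|x a y b xa yb|i _]; first exact: ip0l.
  by rewrite ipDl xa yb.
exact: ipZl.
Qed.

Lemma ip0r w : h w 0 = 0.
Proof. by rewrite (ip_conj hq 0) ip0l conjC0. Qed.

Lemma ipZr c u w : h w (c *: u) = c^* * h w u.
Proof. by rewrite (ip_conj hq (c *: u) w) ipZl rmorphM [in RHS](ip_conj hq u w). Qed.

Lemma ip_sym0 u v : h u v = 0 -> h v u = 0.
Proof. by move=> uv; rewrite (ip_conj hq u) uv conjC0. Qed.

(** Parseval's identity: expanding the first argument of [h x x] gives the
    products [h x (u i) * h (u i) x], which are square moduli. *)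
Lemma ip_parseval n (u : 'I_n -> V) x : x = \sum_i h x (u i) *: u i ->
  q x ^+ 2 = \sum_i rnorm (h x (u i)) ^+ 2.
Proof.
move=> xE; apply: (@complexI R); rewrite -(ip_norm hq) rmorph_sum {1}xE ip_suml.
by apply: eq_bigr => i _; rewrite (ip_conj hq x) mul_conj.
Qed.

(** Linearly dependent vectors become zeros instead of being dropped, so that
    the number of vectors does not change. *)
Lemma gram_schmidt_nat n (v : nat -> V) : exists u : nat -> V,
  [/\ forall s t, (s < n)%N -> (t < n)%N -> s != t -> h (u s) (u t) = 0,
      forall t, (t < n)%N -> h (u t) (u t) = 1 \/ u t = 0 &
      forall s, (s < n)%N -> v s = \sum_(t < n) h (v s) (u t) *: u t].
Proof.
elim: n => [|n [u [uo uu uv]]]; first by exists (fun=> 0).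
pose p := \sum_(t < n) h (v n) (u t) *: u t; pose w := v n - p.
have wu s : (s < n)%N -> h w (u s) = 0.
  move=> sn; rewrite /w -scaleN1r addrC (ip_linear hq) mulN1r ip_suml.
  rewrite (bigD1 (Ordinal sn))//= big1 ?addr0; last first.
    by move=> t ts; rewrite uo ?mulr0//; apply: contra ts => /eqP ts; exact/eqP/val_inj.
  by have [->|->] := uu _ sn; [rewrite mulr1 addNr | rewrite !ip0r mulr0 oppr0 addr0].
(* If [w = 0] then [un = 0], since the inverse of [0] is [0]. *)
pose un := (((q w)^-1)%:C)%C *: w.
pose u' s := if s == n then un else u s.
have u'n : u' n = un by rewrite /u' eqxx.
have u'lt s : (s < n)%N -> u' s = u s by move=> sn; rewrite /u' ltn_eqF.
have unu s : (s < n)%N -> h un (u s) = 0 by move=> sn; rewrite ipZl wu ?mulr0.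
have wE : w = h (v n) un *: un.
  have -> : v n = w + p by rewrite subrK.
  rewrite ipDl [h p _]ip_suml big1 ?addr0; last first.
    by move=> t _; rewrite (ip_sym0 (unu t (ltn_ord t))) mulr0.
  rewrite {2}/un ipZr (ip_norm hq) conj_real /un scalerA -!rmorphM.
  have [qw|qw] := eqVneq (q w) 0; first by rewrite (ip_definite hq qw) !scaler0.
  by rewrite (_ : _ * _ = 1) ?scale1r//; field.
exists u'; split.
- move=> s t; rewrite !ltnS (leq_eqVlt s) (leq_eqVlt t) => /predU1P[->|sn] /predU1P[->|tn].
  + by rewrite eqxx.
  + by move=> _; rewrite u'n u'lt// unu.
  + by move=> _; rewrite u'n u'lt// ip_sym0// unu.
  + by move=> st; rewrite !u'lt// uo.
- move=> t; rewrite ltnS leq_eqVlt => /predU1P[->|tn]; last by rewrite u'lt//; exact: uu.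
  rewrite u'n; have [w0|w0] := eqVneq w 0; [right|left].
    by rewrite /un w0 scaler0.
  have qw : q w != 0 by apply: contra w0 => /eqP/(ip_definite hq)->.
  rewrite /un ipZr ipZl conj_real (ip_norm hq) -!rmorphM.
  by rewrite (_ : _ * _ = 1)//; field.
- have sumE x : \sum_(t < n) h x (u' t) *: u' t = \sum_(t < n) h x (u t) *: u t.
    by apply: eq_bigr => t _; rewrite u'lt.
  move=> s; rewrite ltnS big_ord_recr/= sumE u'n leq_eqVlt => /predU1P[->|sn].
    by rewrite -/p -wE addrC subrK.
  have -> : h (v s) un = 0; last by rewrite scale0r addr0; exact: uv.
  rewrite (uv _ sn) ip_suml big1// => t _.
  by rewrite (ip_sym0 (unu t (ltn_ord t))) mulr0.
Qed.

Lemma gram_schmidt n (v : 'I_n -> V) : exists u : 'I_n -> V,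
  [/\ forall s t, s != t -> h (u s) (u t) = 0,
      forall t, h (u t) (u t) = 1 \/ u t = 0 &
      forall s, v s = \sum_t h (v s) (u t) *: u t].
Proof.
have [u [uo uu uv]] := gram_schmidt_nat n
  (fun i => if insub i is Some j then v j else 0).
exists (fun i => u i); split=> [s t st|t|s]; [exact: uo|exact: uu|].
by have := uv s (ltn_ord s); rewrite valK.
Qed.

(** No vector produced by Gram-Schmidt from a basis vanishes: the matrices [A]
    and [B] that express one family in terms of the other are inverse to each
    other, and a zero vector would give a zero row of [B]. *)
Lemma orthonormal_basis n : has_dim n V -> exists u : 'I_n -> V,
  (forall s t, h (u s) (u t) = (s == t)%:R) /\
  forall x, x = \sum_t h x (u t) *: u t.
Proof.
move=> [v [vfree vspan]]; have [u [uo uu uv]] := gram_schmidt v.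
pose A : 'M[C]_n := \matrix_(s, t) h (v s) (u t).
have {vspan}spanv x : {c : 'I_n -> C | x = \sum_i c i *: v i} by apply: cid; exact: vspan.
pose B : 'M[C]_n := \matrix_(t, s) sval (spanv (u t)) s.
have uB t : u t = \sum_s B t s *: v s.
  by under eq_bigr do rewrite mxE; exact: (svalP (spanv (u t))).
have AB : A *m B = 1%:M.
  apply/matrixP => s r; apply/eqP; rewrite -subr_eq0; apply/eqP.
  move: r; apply: vfree; under eq_bigr do rewrite !mxE scalerBl scaler_suml.
  rewrite sumrB exchange_big/=; apply/eqP; rewrite subr_eq0; apply/eqP.
  rewrite [RHS](bigD1 s)//= eqxx scale1r [X in _ = _ + X]big1 ?addr0; last first.
    by move=> r rs; rewrite eq_sym (negbTE rs) scale0r.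
  rewrite [RHS]uv; apply: eq_bigr => t _; rewrite [X in _ = _ *: X]uB scaler_sumr.
  by apply: eq_bigr => r _; rewrite scalerA; congr (_ * _ *: _); rewrite mxE.
have BA := mulmx1C AB.
have unit_u t : h (u t) (u t) = 1.
  have [//|ut] := uu t; have /eqP := oner_neq0 C; case.
  transitivity ((1%:M : 'M[C]_n) t t); first by rewrite mxE eqxx.
  rewrite -BA mxE big1// => s _; have -> : B t s = 0; last by rewrite mul0r.
  by move: s; apply: vfree; rewrite -uB.
exists u; split=> [s t|x].
  by have [<-|st] := eqVneq s t; [exact: unit_u | rewrite uo].
have [c ->] := spanv x.
under [RHS]eq_bigr => t _ do rewrite ip_suml scaler_suml.
rewrite exchange_big/=; apply: eq_bigr => s _; rewrite {1}uv scaler_sumr.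
by apply: eq_bigr => t _; rewrite scalerA.
Qed.

End Theory.

Lemma ell2_sqnorm_ord n (c : 'I_n -> C) :
  ell2_sqnorm c = (\sum_i rnorm (c i) ^+ 2)%:E.
Proof.
rewrite /ell2_sqnorm esum_fset; last 2 first.
- exact: finite_finset.
- by move=> i _; rewrite lee_fin sqr_ge0.
rewrite fsbig_finite; last exact: finite_finset.
rewrite -sumEFin; apply: perm_big; apply: uniq_perm => [||i].
- exact: finmap.fset_uniq.
- exact: index_enum_uniq.
- rewrite mem_index_enum in_fset_set; last exact: finite_finset.
  by rewrite in_setT.
Qed.

Lemma rnorm_ell2_ord n (c : ell2 R 'I_n) :
  rnorm c ^+ 2 = \sum_i rnorm (val c i) ^+ 2.
Proof.
rewrite /rnorm norm_ell2E /= sqr_sqrtr ?fine_ge0 ?ell2_sqnorm_ge0//.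
by rewrite ell2_sqnorm_ord.
Qed.

Lemma square_summable_ord n (c : 'I_n -> C) : c \in @square_summable R 'I_n.
Proof. by apply/asboolP; rewrite ell2_sqnorm_ord ltry. Qed.

(** An inner product norm [q] equivalent to the given norm provides an
    orthonormal basis, and the coordinates in it an isometry between [q] and
    the norm of l2. *)
Lemma banach_mazur_le n (E : normedModType C) (h : E -> E -> C) (q : E -> R) (al be : R) :
  inner_product h q -> has_dim n E -> 0 <= al -> 0 <= be ->
  (forall x, rnorm x <= al * q x) -> (forall x, q x <= be * rnorm x) ->
  (banach_mazur E (ell2 R 'I_n) <= (be * al)%:E)%E.
Proof.
move=> hq dimE al0 be0 hal hbe; have [u [uo ue]] := orthonormal_basis hq dimE.
pose F (x : E) : ell2 R 'I_n := exist _ (fun t => h x (u t)) (square_summable_ord _).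
pose G (c : ell2 R 'I_n) : E := \sum_t val c t *: u t.
have lF : linear F.
  move=> c x y; apply: val_inj; rewrite linearP; apply/funext => t /=.
  exact: (ip_linear hq).
have lG : linear G.
  move=> c x y; rewrite /G scaler_sumr -big_split; apply: eq_bigr => t _.
  by rewrite linearP /= scalerA -scalerDl.
have FG : cancel G F.
  move=> c; apply: val_inj; apply/funext => t /=; rewrite /G (ip_suml hq).
  rewrite (bigD1 t)//= uo eqxx mulr1 big1 ?addr0// => s st.
  by rewrite uo (negbTE st) mulr0.
have GF : cancel F G by move=> x; rewrite /G [RHS]ue.
have nF x : rnorm (F x) = q x.
  apply/eqP; rewrite -(@eqrXn2 _ 2) ?rnorm_ge0 ?(ip_norm_ge0 hq)//; apply/eqP.
  by rewrite rnorm_ell2_ord (ip_parseval hq (ue x)).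
have bF x : rnorm (F x) <= be * rnorm x by rewrite nF.
have bG c : rnorm (G c) <= al * rnorm c.
  by apply: le_trans (hal _) _; rewrite -nF FG.
have pair : isomorphism_pair (mk_linear lF) (mk_linear lG).
  exact: (@isomorphism_pair_of_bounds _ _ _ _ _ be al).
apply: (@le_trans _ _ (opnorm (mk_linear lF) * opnorm (mk_linear lG))%E).
  by apply: ereal_inf_lbound; exists (mk_linear lF), (mk_linear lG).
by rewrite EFinM lee_pmul ?opnorm_ge0//; apply: opnorm_le.
Qed.

End HermitianForms.

(** * The inner product of l2 *)

Section Ell2InnerProduct.
Context {R : realType}.
Local Notation C := R[i].
Local Notation H := (ell2 R nat).
Implicit Types (x y z : H) (u v : nat -> C) (l m : C).

Lemma sqsum_cvg x : sqsum n (val x) @[n --> \oo] --> rnorm x ^+ 2.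
Proof.
have nd : {homo (fun n => sqsum n (val x)) : n m / (n <= m)%N >-> n <= m}.
  by move=> n m; exact: le_sqsum.
have ub n : sqsum n (val x) <= rnorm x ^+ 2.
  by rewrite rnorm_ell2; apply: sqsum_le_l2norm; exact: valP.
have cv : cvgn (fun n => sqsum n (val x)).
  apply: nondecreasing_is_cvgn => //; exists (rnorm x ^+ 2) => _ [n _ <-]; exact: ub.
suff <- : limn (fun n => sqsum n (val x)) = rnorm x ^+ 2 by [].
apply/eqP; rewrite eq_le; apply/andP; split.
  by apply: limr_le => //; near=> n; exact: ub.
rewrite rnorm_ell2 -lee_fin -sqnormE ?(valP x)//; apply: sqnorm_le => n.
exact: nondecreasing_cvgn_le.
Unshelve. all: by end_near. Qed.

Definition complex_tends u l :=
  forall r : R, 0 < r -> \forall n \near \oo, rnorm (u n - l) < r.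

Lemma complex_tends_unique u l m : complex_tends u l -> complex_tends u m -> l = m.
Proof.
move=> ul um; apply/eqP; rewrite -subr_eq0; apply/eqP/rnorm_eq0/eqP.
rewrite eq_le rnorm_ge0 andbT; apply/ler_addgt0Pr => e e0.
have e2 : 0 < e / 2 by rewrite divr_gt0.
have [n [/= h1 h2]] := filter_ex (filterI (ul _ e2) (um _ e2)).
rewrite add0r [e]splitr (_ : l - m = (u n - m) - (u n - l)); last by ring.
by rewrite (le_trans (rnormD _ _))// rnormN lerD// ltW.
Qed.

Lemma complex_tendsD u v l m : complex_tends u l -> complex_tends v m ->
  complex_tends (fun n => u n + v n) (l + m).
Proof.
move=> ul vm e e0; have e2 : 0 < e / 2 by rewrite divr_gt0.
apply: filterS2 (ul _ e2) (vm _ e2) => n h1 h2.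
rewrite (_ : _ - _ = (u n - l) + (v n - m)); last by ring.
by rewrite [e]splitr (le_lt_trans (rnormD _ _))// ltrD.
Qed.

Lemma complex_tendsM (c : C) u l : complex_tends u l ->
  complex_tends (fun n => c * u n) (c * l).
Proof.
move=> ul e e0; have c0 : 0 < 1 + rnorm c by rewrite ltr_pwDl ?rnorm_ge0.
have d0 : 0 < e / (1 + rnorm c) by rewrite divr_gt0.
apply: filterS (ul _ d0) => n; rewrite ltr_pdivlMr// => h.
rewrite -mulrBr rnormM; apply: le_lt_trans h.
by rewrite mulrC ler_wpM2l ?rnorm_ge0// lerDr.
Qed.

Lemma complex_tends_real (u : nat -> R) (l : R) : u n @[n --> \oo] --> l ->
  complex_tends (fun n => ((u n)%:C)%C) (l%:C)%C.
Proof.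
move=> /cvgrPdist_lt ul e /ul; apply: filterS => n /= h.
by rewrite -rmorphB rnorm_real distrC.
Qed.

Definition partial_dot n x y : C := \sum_(i < n) val x i * (val y i)^*.

(** The inner product is defined by polarization, which only involves norms.
    Its linearity is inherited from the finite sums [partial_dot], of which it
    is the limit. *)
Definition dot x y : C := 4^-1 * (
    ((rnorm (x + y) ^+ 2)%:C)%C - ((rnorm (x - y) ^+ 2)%:C)%C
    + 'i * ((rnorm (x + 'i *: y) ^+ 2)%:C)%C
    - 'i * ((rnorm (x - 'i *: y) ^+ 2)%:C)%C).

Lemma polarization (a b : C) : a * b^* = 4^-1 * (
    ((rnorm (a + b) ^+ 2)%:C)%C - ((rnorm (a - b) ^+ 2)%:C)%C
    + 'i * ((rnorm (a + 'i * b) ^+ 2)%:C)%C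
    - 'i * ((rnorm (a - 'i * b) ^+ 2)%:C)%C).
Proof.
rewrite -!mul_conj !rmorphD !rmorphN !rmorphM /= conjCi.
have i2 : 'i * 'i = -1 :> C by rewrite -expr2 sqrCi.
have four : (4 : C) != 0 by rewrite pnatr_eq0.
apply: (mulfI four); rewrite mulVKf//.
move: i2; move: ('i : C) (a^*) (b^*) => I a' b' i2.
by ring: i2.
Qed.

Lemma partial_dot_polarization n x y : partial_dot n x y = 4^-1 * (
    ((sqsum n (val (x + y)))%:C)%C - ((sqsum n (val (x - y)))%:C)%C
    + 'i * ((sqsum n (val (x + 'i *: y)))%:C)%C
    - 'i * ((sqsum n (val (x - 'i *: y)))%:C)%C).
Proof.
rewrite /partial_dot /sqsum !rmorph_sum !mulr_sumr -!sumrB -!big_split -sumrB mulr_sumr.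
by apply: eq_bigr => i _; exact: polarization.
Qed.

Lemma partial_dot_tends x y : complex_tends (fun n => partial_dot n x y) (dot x y).
Proof.
have cv z : complex_tends (fun n => ((sqsum n (val z))%:C)%C) ((rnorm z ^+ 2)%:C)%C.
  exact/complex_tends_real/sqsum_cvg.
rewrite (_ : (fun n => _) = fun n => 4^-1 * (
    ((sqsum n (val (x + y)))%:C)%C + (-1) * ((sqsum n (val (x - y)))%:C)%C
    + 'i * ((sqsum n (val (x + 'i *: y)))%:C)%C
    + (- 'i) * ((sqsum n (val (x - 'i *: y)))%:C)%C)); last first.
  by apply/funext => n; rewrite partial_dot_polarization mulN1r mulNr.
rewrite (_ : dot x y = 4^-1 * (
    ((rnorm (x + y) ^+ 2)%:C)%C + (-1) * ((rnorm (x - y) ^+ 2)%:C)%C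
    + 'i * ((rnorm (x + 'i *: y) ^+ 2)%:C)%C
    + (- 'i) * ((rnorm (x - 'i *: y) ^+ 2)%:C)%C)); last by rewrite mulN1r mulNr.
apply: complex_tendsM.
apply: complex_tendsD (complex_tendsM _ (cv _)); apply: complex_tendsD (complex_tendsM _ (cv _)).
exact: complex_tendsD (cv _) (complex_tendsM _ (cv _)).
Qed.

Lemma dot_inner_product : inner_product dot (fun x => rnorm x).
Proof.
split=> [c x y z|x y|x|x|x]; last 2 first.
- exact: rnorm_ge0.
- exact: rnorm_eq0.
- apply: (complex_tends_unique (partial_dot_tends (c *: x + y) z)).
  have -> : (fun n => partial_dot n (c *: x + y) z) =
      (fun n => c * partial_dot n x z + partial_dot n y z).
    apply/funext => n; rewrite /partial_dot mulr_sumr -big_split; apply: eq_bigr => i _ /=.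
    by rewrite mulrA -mulrDl.
  by apply: complex_tendsD (partial_dot_tends _ _); apply: complex_tendsM; exact: partial_dot_tends.
- have i2 : 'i * 'i = -1 :> C by rewrite -expr2 sqrCi.
  have ri : rnorm ('i : C) = 1 by rewrite /rnorm normCi.
  rewrite /dot; have -> : rnorm (y - 'i *: x) = rnorm (x + 'i *: y).
    rewrite -[LHS]mul1r -ri -rnormZ scalerBr scalerA i2 scaleN1r opprK addrC//.
  have -> : rnorm (y + 'i *: x) = rnorm (x - 'i *: y).
    rewrite -[LHS]mul1r -ri -rnormZ scalerDr scalerA i2 scaleN1r -rnormN.
    by rewrite opprD opprK addrC.
  rewrite [y + x]addrC -[rnorm (y - x)]rnormN opprB.
  move: (rnorm _ ^+ 2) (rnorm _ ^+ 2) (rnorm _ ^+ 2) (rnorm _ ^+ 2) => p r s t.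
  rewrite [RHS]rmorphM fmorphV rmorph_nat !(rmorphB, rmorphD, rmorphM) /= !conj_real conjCi.
  by ring.
- apply: (complex_tends_unique (partial_dot_tends x x)).
  have -> : (fun n => partial_dot n x x) = (fun n => ((sqsum n (val x))%:C)%C).
    apply/funext => n; rewrite /partial_dot /sqsum rmorph_sum; apply: eq_bigr => i _.
    by rewrite mul_conj.
  exact/complex_tends_real/sqsum_cvg.
Qed.

End Ell2InnerProduct.

(** * Finite-dimensional subspaces are close to Hilbert space *)

Section UpperBound.
Context {R : realType}.
Local Notation C := R[i].
Local Notation H := (ell2 R nat).
Variables (group : nat -> nat) (f : nat -> R -> R) (lip : nat -> R).
Local Notation Z := (twisted group f).
Hypothesis f_lip : forall g s t, 0 <= s -> 0 <= t ->
     s * t * `|f g s - f g t| <= lip g * (s ^+ 2 + t ^+ 2).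
Variables (n : nat) (low : pred nat) (M e : R).
Hypotheses (M0 : 0 <= M) (e0 : 0 <= e) (ne : n%:R * (2 * e) <= 1).
Hypothesis f_low : forall g s, low g -> 0 <= s <= 1 -> `|f g s| <= M.
Hypothesis f_high : forall g, ~~ low g -> lip g <= e.

Definition restrict (p : pred nat) (x : nat -> C) : nat -> C :=
  fun i => if p (group i) then x i else 0.

Lemma restrict_square_summable p (x : H) :
  restrict p (val x) \in @square_summable R nat /\
  l2norm (restrict p (val x)) <= l2norm (val x).
Proof.
apply: le_l2norm (valP x) => i; rewrite /restrict; case: ifP => // _.
by rewrite rnorm0 rnorm_ge0.
Qed.

Definition restriction p (x : H) : H :=
  exist _ (restrict p (val x)) (restrict_square_summable p x).1.

Lemma rnorm_restriction p x : rnorm (restriction p x) <= rnorm x.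
Proof. by rewrite !rnorm_ell2; exact: (restrict_square_summable p x).2. Qed.

Lemma restriction_linear p : linear (restriction p).
Proof.
have restrictD c (x y : nat -> C) i : restrict p (fun j => c * x j + y j) i =
    c * restrict p x i + restrict p y i.
  by rewrite /restrict; case: ifP; rewrite // mulr0 addr0.
by move=> c x y; apply: val_inj; apply/funext => i; exact: restrictD.
Qed.

HB.instance Definition _ p :=
  GRing.isLinear.Build C H H _ (restriction p) (restriction_linear p).

Lemma restriction_idem p x : restriction p (restriction p x) = restriction p x.
Proof.
have idem (y : nat -> C) i : restrict p (restrict p y) i = restrict p y i.
  by rewrite /restrict; case: (p _).
by apply: val_inj; apply/funext => i; exact: idem.
Qed.

Variable E : lsubspace Z.
Hypothesis dimE : has_dim n (subspace_type E).
Local Notation V := (subspace_type E).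

(** The vectors [u t] form an orthonormal system (up to zero vectors) that spans
    the projection of [E] to the high groups, and [l t] are the coordinates in
    it.  Gram-Schmidt takes place in l2; projecting its output once more leaves
    the expansion unchanged, since both sides are projected, and makes the
    support of [u t] evident. *)
Lemma linearizing_frame : exists u : 'I_n -> H,
  [/\ forall t, rnorm (u t) <= 1,
      forall t i, val (u t) i != 0 -> lip (group i) <= e &
      exists l : 'I_n -> V -> C, [/\
      forall t (c : C) (x y : V), l t (c *: x + y) = c * l t x + l t y,
      forall t (x : V), rnorm (l t x) <= rnorm (second (val x)) &
      forall x : V, restriction (predC low) (second (val x)) = \sum_t l t x *: u t]].
Proof.
have ip := @dot_inner_product R.
have [b [_ bspan]] := dimE.
pose hi (x : V) : H := restriction (predC low) (second (val x)).
have hiD c (x y : V) : hi (c *: x + y) = c *: hi x + hi y.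
  by rewrite /hi !linearP.
have hi_sum (c : 'I_n -> C) : hi (\sum_i c i *: b i) = \sum_i c i *: hi (b i).
  by rewrite /hi !linear_sum; apply: eq_bigr => i _; rewrite !linearZ.
have [u [uo uu ue]] := gram_schmidt ip (fun s => hi (b s)).
have hiE x : hi x = \sum_t dot (hi x) (u t) *: u t.
  have [c ->] := bspan x; rewrite hi_sum.
  under [RHS]eq_bigr => t _ do rewrite (ip_suml ip) scaler_suml.
  rewrite exchange_big/=; apply: eq_bigr => s _; rewrite {1}ue scaler_sumr.
  by apply: eq_bigr => t _; rewrite scalerA.
exists (fun t => restriction (predC low) (u t)); split.
- move=> t; apply: le_trans (rnorm_restriction _ _) _.
  have [u1|->] := uu t; last by rewrite rnorm0.
  have : rnorm (u t) ^+ 2 = 1 by apply: (@complexI R); rewrite -(ip_norm ip).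
  by move=> ut; rewrite -(@expr_le1 _ 2) ?rnorm_ge0// ut.
- move=> t i; rewrite /= /restrict; case: ifP => [lowi _|_]; last by rewrite eqxx.
  exact: f_high.
exists (fun t x => dot (hi x) (u t)); split.
- by move=> t c x y; rewrite hiD (ip_linear ip).
- move=> t x; apply: le_trans (rnorm_restriction (predC low) _).
  rewrite -(@ler_pXn2r _ 2) ?nnegrE ?rnorm_ge0//.
  rewrite [leRHS](ip_parseval ip (hiE x)) (bigD1 t)//= lerDl.
  by apply: sumr_ge0 => s _; rewrite sqr_ge0.
- move=> x; transitivity (restriction (predC low) (hi x)).
    by rewrite restriction_idem.
  by rewrite -linear_comb -hiE.
Qed.

(** With [L x] the sum of the [l t x * twist (u t)], the twisted
    functional at [(y, x)] differs from [<y - L x, a>] by at most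
    [(1 + M) * rnorm x]: at most [1] comes from the high groups, by almost
    symmetry for each of the [n] vectors [u t], and at most [M] from the low
    ones.  Hence the norm of [E] is equivalent to the Hilbert norm with square
    [rnorm (y - L x) ^+ 2 + rnorm x ^+ 2], with constants [2 + M] and
    [3 + M]. *)
Lemma hilbert_dist_twisted_le : (hilbert_dist n E <= ((3 + M) * (2 + M))%:E)%E.
Proof.
have [u [u1 ulip [l [lD lN lE]]]] := linearizing_frame.
pose y (x : V) : nat -> C := (val (val x)).1.
pose L (x : V) : nat -> C := fun i => \sum_t l t x * twist group f (val (u t)) i.
pose T (x : V) : nat -> C := fun i => y x i - L x i.
pose s (x : V) : H := second (val x).
have key (x : V) m a : (forall i, (m <= i)%N -> a i = 0) -> sqsum m a <= 1 ->
    rnorm (pairing group f true m a (val (val x)) - \sum_(i < m) a i * T x i)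
      <= (1 + M) * rnorm (s x).
  move=> a0 a1.
  pose lo := \sum_(i < m) a i * (((weight group f a i)%:C)%C * val (restriction low (s x)) i).
  pose hi t := \sum_(i < m) a i *
    (((weight group f a i - weight group f (val (u t)) i)%:C)%C * val (u t) i).
  have -> : pairing group f true m a (val (val x)) - \sum_(i < m) a i * T x i =
      lo + \sum_t l t x * hi t.
    under [X in _ = _ + X]eq_bigr => t _ do rewrite /hi mulr_sumr.
    rewrite exchange_big /lo /pairing -sumrB -big_split/=; apply: eq_bigr => i _.
    have -> : (val (val x)).2 i = val (restriction low (s x)) i +
        \sum_t l t x * val (u t) i.
      have := congr1 (fun z : H => val z i) (lE x).
      have -> : val (\sum_t l t x *: u t) i = \sum_t l t x * val (u t) i.
        by rewrite raddf_sum fct_sumE; apply: eq_bigr.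
      move=> <-; rewrite /= /restrict /=; case: ifP => _ /=; rewrite ?addr0 ?add0r//.
    rewrite /T /L -/(y x i); under [X in _ = _ + X]eq_bigr => t _.
      rewrite (_ : _ * _ = a i * (((weight group f a i)%:C)%C * (l t x * val (u t) i)
        + l t x * twist group f (val (u t)) i)); last first.
        by rewrite /twist rmorphB /=; ring.
      over.
    rewrite -mulr_sumr -mulrBr -mulrDr; congr (_ * _).
    by rewrite big_split/= -mulr_sumr; ring.
  rewrite (le_trans (rnormD _ _))// mulrDl mul1r addrC lerD//; last first.
    apply: le_trans (weight_bounded_sum M0 _ a0 a1 (valP (restriction low (s x)))) _.
      move=> i t; rewrite /= /restrict; case: ifP => [lowi _|_]; last by rewrite eqxx.
      exact: f_low.
    by rewrite ler_wpM2l// -rnorm_ell2 rnorm_restriction.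
  apply: le_trans (rnorm_sum _ _ _) _.
  apply: (@le_trans _ _ (\sum_(t < n) rnorm (s x) * (2 * e))).
    apply: ler_sum => t _; rewrite rnormM ler_pM ?rnorm_ge0 ?lN//.
    apply: (weight_almost_symmetric f_lip e0 (ulip t) a0 a1); first exact: valP.
    by rewrite -rnorm_ell2.
  rewrite sumr_const card_ord -[leLHS]mulr_natl mulrCA.
  by rewrite ler_piMr ?rnorm_ge0.
have Tbound (x : V) : T x \in @square_summable R nat /\ l2norm (T x) <= (2 + M) * rnorm x.
  apply: l2norm_dual => [|m a a0 a1]; first by rewrite mulr_ge0 ?addr_ge0 ?rnorm_ge0.
  have := key x m a a0 a1; set p := pairing _ _ _ _ _ _; set r := \sum_(i < m) _ => h.
  rewrite (_ : r = p - (p - r)); last by rewrite opprB addrC subrK.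
  rewrite (le_trans (rnormD _ _))// rnormN (_ : 2 + M = 1 + (1 + M)); last by ring.
  rewrite mulrDl mul1r lerD//; first exact: (pairing_le (val x)).
  by apply: le_trans h _; rewrite ler_wpM2l ?addr_ge0//; exact: rnorm_second.
pose TH (x : V) : H := exist _ (T x) (Tbound x).1.
have yD (c : C) (x x' : V) i : y (c *: x + x') i = c * y x i + y x' i.
  by rewrite /y !linearP.
have TDi (c : C) (x x' : V) i : T (c *: x + x') i = c * T x i + T x' i.
  rewrite /T yD; have -> : L (c *: x + x') i = c * L x i + L x' i; last by ring.
  rewrite /L mulr_sumr -big_split; apply: eq_bigr => t _ /=.
  by rewrite lD mulrDl mulrA.
have TD (c : C) (x x' : V) : TH (c *: x + x') = c *: TH x + TH x'.
  apply: val_inj; apply/funext => i; exact: TDi.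
have sD (c : C) (x x' : V) : s (c *: x + x') = c *: s x + s x' by rewrite /s !linearP.
have ip := @dot_inner_product R.
pose q (x : V) : R := Num.sqrt (rnorm (TH x) ^+ 2 + rnorm (s x) ^+ 2).
have qT x : rnorm (TH x) <= q x.
  by rewrite -[leLHS]ger0_norm ?rnorm_ge0// -sqrtr_sqr ler_wsqrtr// lerDl sqr_ge0.
have qs x : rnorm (s x) <= q x.
  by rewrite -[leLHS]ger0_norm ?rnorm_ge0// -sqrtr_sqr ler_wsqrtr// lerDr sqr_ge0.
have qle x : q x <= rnorm (TH x) + rnorm (s x).
  rewrite -[leRHS]ger0_norm ?addr_ge0 ?rnorm_ge0// -sqrtr_sqr ler_wsqrtr//.
  by rewrite sqrrD addrAC lerDl mulrn_wge0// mulr_ge0 ?rnorm_ge0.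
have up x : rnorm x <= (2 + M) * q x.
  have q0 : 0 <= q x by exact: sqrtr_ge0.
  apply: (rnorm_twisted_le (z := val x)) => t m a a0 a1; case: t; last first.
    apply: le_trans (_ : q x <= _); last by rewrite ler_peMl//; move: M0; lra.
    apply: le_trans (qs x); rewrite rnorm_ell2 -[leRHS]mul1r.
    apply: (@cauchy_schwarz_sum _ m a (val (s x))); rewrite ?l2norm_ge0 ?expr1n//.
    by apply: sqsum_le_l2norm; exact: valP.
  have := key x m a a0 a1; set p := pairing _ _ _ _ _ _; set r := \sum_(i < m) _ => h.
  rewrite -(subrK r p) (le_trans (rnormD _ _))// (_ : 2 + M = (1 + M) + 1); last by ring.
  rewrite mulrDl mul1r lerD//; first by rewrite (le_trans h)// ler_wpM2l ?addr_ge0.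
  apply: le_trans (qT x); rewrite rnorm_ell2 -[leRHS]mul1r.
  apply: (@cauchy_schwarz_sum _ m a (T x)); rewrite ?l2norm_ge0 ?expr1n//.
  by apply: sqsum_le_l2norm; exact: (Tbound x).1.
pose h (x x' : V) := dot (TH x) (TH x') + dot (s x) (s x').
apply: (@banach_mazur_le _ n _ h q (2 + M) (3 + M)) => //.
- split=> [c x x' w|x x'|x|x|x].
  + by rewrite /h TD sD !(ip_linear ip) mulrDr addrACA.
  + by rewrite /h (ip_conj ip (TH x)) (ip_conj ip (s x)) rmorphD.
  + have -> : q x ^+ 2 = rnorm (TH x) ^+ 2 + rnorm (s x) ^+ 2.
      by rewrite sqr_sqrtr ?addr_ge0 ?sqr_ge0.
    by rewrite /h !(ip_norm ip) [RHS]rmorphD.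
  + exact: sqrtr_ge0.
  + move=> qx; apply: rnorm_eq0; apply/eqP; rewrite eq_le rnorm_ge0 andbT.
    by rewrite (le_trans (up x))// qx mulr0.
- by rewrite addr_ge0.
- by rewrite addr_ge0.
- move=> x; apply: le_trans (qle x) _; rewrite (_ : 3 + M = (2 + M) + 1); last by ring.
  rewrite mulrDl mul1r lerD//; last exact: rnorm_second.
  by rewrite rnorm_ell2; exact: (Tbound x).2.
Qed.

End UpperBound.

(** * Signs in Hilbert space and a lower bound for the distance *)

Section TypeTwo.
Context {R : realType}.
Local Notation C := R[i].

Lemma complex_parallelogram (a b : C) :
  rnorm (a + b) ^+ 2 + rnorm (a - b) ^+ 2 = 2 * (rnorm a ^+ 2 + rnorm b ^+ 2).
Proof.
have : (a + b) * (a + b)^* + (a - b) * (a - b)^* =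
    (a * a^* + b * b^*) + (a * a^* + b * b^*).
  by rewrite rmorphB rmorphD; ring.
rewrite !mul_conj -!(rmorphD (real_complex R)) => /(@complexI R) ->.
by rewrite mulr_natl mulr2n.
Qed.

Lemma parallelogram n (u v : ell2 R 'I_n) :
  rnorm (u + v) ^+ 2 + rnorm (u - v) ^+ 2 = 2 * (rnorm u ^+ 2 + rnorm v ^+ 2).
Proof.
rewrite !rnorm_ell2_ord -!big_split mulr_sumr; apply: eq_bigr => i _.
exact: complex_parallelogram.
Qed.

(** The signs are chosen greedily: by the parallelogram law, one of [w + v] and
    [w - v] has square norm at most that of [w] plus that of [v]. *)
Lemma choose_signs n m (v : nat -> ell2 R 'I_n) : exists s : nat -> C,
  (forall i, rnorm (s i) = 1) /\
  rnorm (\sum_(i < m) s i *: v i) ^+ 2 <= \sum_(i < m) rnorm (v i) ^+ 2.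
Proof.
elim: m => [|m [s [s1 sle]]].
  by exists (fun=> 1); split=> [_|]; rewrite ?rnorm1// !big_ord0 rnorm0 expr0n.
set w := \sum_(i < m) _ in sle.
pose s' (c : C) i := if i == m then c else s i.
have s'E c : \sum_(i < m.+1) s' c i *: v i = w + c *: v m.
  rewrite big_ord_recr/= {2}/s' eqxx; congr (_ + _); apply: eq_bigr => i _.
  by rewrite /s' ltn_eqF.
have s'1 c : rnorm c = 1 -> forall i, rnorm (s' c i) = 1.
  by move=> c1 i; rewrite /s'; case: eqP.
rewrite big_ord_recr/=; have par := parallelogram w (v m).
have [le|lt] := lerP (rnorm (w + v m) ^+ 2) (\sum_(i < m) rnorm (v i) ^+ 2 + rnorm (v m) ^+ 2).
  by exists (s' 1); rewrite s'E scale1r; split=> //; apply: s'1; exact: rnorm1.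
exists (s' (-1)); rewrite s'E scaleN1r; split; first by apply: s'1; rewrite rnormN rnorm1.
by move: par sle lt; set a := rnorm w ^+ 2; lra.
Qed.

Lemma opnorm_bound (U V : normedModType C) (h : {linear U -> V}) (A : R) (x : U) :
  opnorm h = A%:E -> rnorm (h x) <= A * rnorm x.
Proof.
move=> hA; have [->|x0] := eqVneq x 0; first by rewrite linear0 !rnorm0 mulr0.
have r0 : 0 < rnorm x.
  by rewrite lt_neqAle rnorm_ge0 andbT eq_sym; apply: contra x0 => /eqP/rnorm_eq0->.
rewrite -ler_pdivrMr// -lee_fin -hA; apply: ereal_sup_ubound.
have rE : rnorm ((((rnorm x)^-1)%:C)%C : C) = (rnorm x)^-1.
  by rewrite rnorm_real ger0_norm// invr_ge0 ltW.
exists ((((rnorm x)^-1)%:C)%C *: x) => /=; first by rewrite rnormZ rE mulVf ?gt_eqF.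
by rewrite linearZ rnormZ rE mulrC.
Qed.

(** Transport the vectors to Hilbert space, choose signs there so that the sum
    has norm at most [opnorm F * sqrt m], and transport the sum back. *)
Lemma banach_mazur_ge n m (E : normedModType C) (w : 'I_m -> E) (k : R) : (0 < m)%N ->
  (forall i, rnorm (w i) <= 1) ->
  (forall s : nat -> C, (forall i, rnorm (s i) = 1) ->
     k * Num.sqrt m%:R <= rnorm (\sum_(i < m) s i *: w i)) ->
  (k%:E <= banach_mazur E (ell2 R 'I_n))%E.
Proof.
move=> m0 w1 wk; apply: le_ereal_inf_tmp => _ [F [G [[FG GF _ _] ->]]].
have [k0|k0] := lerP k 0.
  by apply: le_trans (mule_ge0 (opnorm_ge0 F) (opnorm_ge0 G)); rewrite lee_fin.
have sm : 0 < Num.sqrt (m%:R : R) by rewrite sqrtr_gt0 ltr0n.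
pose x := \sum_(i < m) (1 : C) *: w i.
have x0 : 0 < rnorm x.
  by apply: lt_le_trans (wk (fun=> 1) (fun=> rnorm1)); rewrite mulr_gt0.
(* This excludes the product of [0] and [+oo], which is [0] by convention. *)
have nz : (opnorm F != 0)%E /\ (opnorm G != 0)%E.
  split; apply/eqP => /opnorm_bound h; move: x0; rewrite -(FG x).
    have -> : F x = 0.
      by apply: rnorm_eq0; apply/eqP; rewrite eq_le rnorm_ge0 andbT (le_trans (h _))// mul0r.
    by rewrite linear0 rnorm0 ltxx.
  by rewrite ltNge (le_trans (h _))// mul0r.
case: nz; move: (opnorm_ge0 F) (opnorm_ge0 G).
case FE : (opnorm F) => [A| |] //; case GE : (opnorm G) => [B| |] // A0 B0 An Bn; last 3 first.
- by rewrite gt0_muley ?leey// lt_def An.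
- by rewrite gt0_mulye ?leey// lt_def Bn.
- by rewrite mulyy leey.
have [s [s1]] := choose_signs m (fun i => if insub i is Some j then F (w j) else 0).
under eq_bigr do rewrite valK; under [leRHS]eq_bigr do rewrite valK; move=> sle.
rewrite -EFinM lee_fin -(ler_pM2r sm).
apply: le_trans (wk s s1) _; rewrite -(FG (\sum_(i < m) s i *: w i)).
apply: le_trans (opnorm_bound _ GE) _; rewrite [A * B]mulrC -mulrA ler_wpM2l//.
rewrite linear_sum; under eq_bigr do rewrite linearZ.
rewrite -(@ler_pXn2r _ 2) ?nnegrE ?mulr_ge0 ?rnorm_ge0 ?sqrtr_ge0//.
apply: le_trans sle _; rewrite exprMn sqr_sqrtr ?ler0n// mulr_natr.
apply: (@le_trans _ _ (\sum_(i < m) A ^+ 2)); last by rewrite sumr_const card_ord.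
apply: ler_sum => i _; rewrite lerXn2r ?nnegrE ?rnorm_ge0//.
by apply: le_trans (opnorm_bound _ FE) _; rewrite ler_piMr// w1.
Qed.

End TypeTwo.

(** * Linear combinations in subspaces of finite codimension *)

Section LinearAlgebra.
Context {R : realType}.
Local Notation C := R[i].

(** A combination lies in [S] when its coordinates in the quotient vanish.
    For [m] families with common coefficients these are [m * d] homogeneous
    linear equations, so [m * d + 1] unknowns suffice. *)
Lemma combination_in_finite_codim (U : lmodType C) (S : lsubspace U) m (v : 'I_m -> nat -> U) :
  finite_codim S -> exists J (al : 'I_J -> C),
    \sum_j rnorm (al j) ^+ 2 = 1 /\ forall i, \sum_j al j *: v i j \in carrier S.
Proof.
move=> [d [b [_ bspan]]]; pose J := (m * d).+1.
have spanP q : {c : 'I_d -> C | q = \sum_t c t *: b t} by apply: cid; exact: bspan.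
pose c j i t := sval (spanP (quotient_proj S (v i j))) t.
pose B : 'M[C]_(J, m * d) := \matrix_(j < J) mxvec (\matrix_(i, t) c j i t).
have kB : kermx B != 0.
  rewrite -mxrank_eq0 mxrank_ker -lt0n subn_gt0.
  by apply: leq_ltn_trans (rank_leq_col B) _; rewrite ltnS.
have [a a0 aB] : exists2 a : 'rV_J, a != 0 & a *m B = 0.
  exists (nz_row (kermx B)); first by rewrite nz_row_eq0.
  by apply/sub_kermxP; exact: nz_row_sub.
have aB0 i t : \sum_j a 0 j * c j i t = 0.
  have h : (a *m B) 0 (mxvec_index i t) = 0 by rewrite aB mxE.
  rewrite -[RHS]h mxE; apply: eq_bigr => j _; congr (_ * _).
  by rewrite mxE mxvecE mxE.
pose r2 := \sum_j rnorm (a 0 j) ^+ 2.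
have r20 : 0 < r2.
  have [j aj] : exists j, a 0 j != 0.
    apply/existsP; apply: contraR a0 => /existsPn h; apply/eqP/rowP => j.
    by rewrite mxE; apply/eqP; have := h j; rewrite negbK.
  rewrite /r2 (bigD1 j)//= ltr_pwDl//; last by apply: sumr_ge0 => i _; rewrite sqr_ge0.
  rewrite exprn_gt0// lt_neqAle rnorm_ge0 andbT eq_sym.
  by apply: contra aj => /eqP/rnorm_eq0->.
pose r : R := (Num.sqrt r2)^-1.
exists J, (fun j => (r%:C)%C * a 0 j); split.
  under eq_bigr do rewrite rnormM rnorm_real exprMn.
  rewrite -mulr_sumr -/r2 real_normK ?num_real// exprVn sqr_sqrtr ?(ltW r20)//.
  by rewrite mulVf ?gt_eqF.
move=> i; under eq_bigr do rewrite -scalerA.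
rewrite -scaler_sumr rpredZ//.
rewrite -[X in X \in _]subr0 -quotient_projE linear0 linear_sum; apply/eqP.
transitivity (\sum_j \sum_t (a 0 j * c j i t) *: b t).
  apply: eq_bigr => j _; rewrite linearZ /=.
  rewrite {1}(svalP (spanP (quotient_proj S (v i j)))) scaler_sumr.
  by apply: eq_bigr => t _; rewrite scalerA.
rewrite exchange_big/= big1// => t _.
by rewrite -scaler_suml aB0 scale0r.
Qed.

Variables (U : lmodType C) (m : nat) (u : 'I_m -> U).

Definition span_pred : {pred U} := fun z => `[< exists c : 'I_m -> C, z = \sum_i c i *: u i >].

Lemma span_submod : submod_closed span_pred.
Proof.
split=> [|a _ _ /asboolP[c ->] /asboolP[c' ->]]; apply/asboolP.
  by exists (fun=> 0); rewrite big1// => i _; rewrite scale0r.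
exists (fun i => a * c i + c' i); rewrite scaler_sumr -big_split; apply: eq_bigr => i _.
by rewrite /= scalerA -scalerDl.
Qed.

Definition linear_span : lsubspace U := LSubspace span_submod.

Lemma mem_linear_span i : u i \in carrier linear_span.
Proof.
apply/asboolP; exists (fun j => (j == i)%:R); rewrite (bigD1 i)//= eqxx scale1r.
by rewrite big1 ?addr0// => j ji; rewrite (negbTE ji) scale0r.
Qed.

Lemma linear_span_sub (S : lsubspace U) : (forall i, u i \in carrier S) ->
  {subset carrier linear_span <= carrier S}.
Proof.
by move=> uS _ /asboolP[c ->]; apply: rpred_sum => i _; rewrite rpredZ// uS.
Qed.

Definition span_vector (i : 'I_m) : subspace_type linear_span :=
  exist _ (u i) (mem_linear_span i).

Lemma val_span_sum (c : 'I_m -> C) :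
  val (\sum_i c i *: span_vector i) = \sum_i c i *: u i.
Proof. by rewrite raddf_sum. Qed.

Lemma dim_linear_span : (forall c : 'I_m -> C, \sum_i c i *: u i = 0 -> forall i, c i = 0) ->
  has_dim m (subspace_type linear_span).
Proof.
move=> ufree; exists span_vector; split=> [c /(congr1 val)|x].
  by rewrite val_span_sum => /ufree.
by have /asboolP[c xE] := valP x; exists c; apply: val_inj; rewrite val_span_sum.
Qed.

End LinearAlgebra.

(** * Badly Hilbertian subspaces in every finite codimension *)

Section LowerBound.
Context {R : realType}.
Local Notation C := R[i].
Variables (group : nat -> nat) (f : nat -> R -> R).
Local Notation Z := (twisted group f).

(** If [x] lives in one group, the weight is a constant there, and the norm of
    the part of [a] in this group compensates its size. *)
Lemma one_group_bound g (x : nat -> C) :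
  (forall s, 0 <= s <= 1 -> `|s * f g s| <= 1) ->
  (forall i, x i != 0 -> group i = g) -> x \in @square_summable R nat ->
  dual_bounded group f (l2norm x) (0, x).
Proof.
move=> fg xg xs t n a a0 a1; rewrite /pairing.
have [as_ al1] := unit_support a0 a1; case: t => /=; last first.
  by rewrite -[leRHS]mul1r cauchy_schwarz_sum ?l2norm_ge0 ?expr1n ?sqsum_le_l2norm.
set q := l2norm (mask group g a).
have q0 : 0 <= q by exact: l2norm_ge0.
have [ms ml] := mask_summable group g as_.
rewrite (eq_bigr (fun i : 'I_n => ((f g q)%:C)%C * (mask group g a i * x i))); last first.
  move=> i _; have [xi|xi] := eqVneq (x i) 0; first by rewrite xi !mulr0 addr0 mulr0.
  by rewrite /mask /weight (xg _ xi) eqxx add0r mulrCA.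
rewrite -mulr_sumr rnormM rnorm_real.
apply: (@le_trans _ _ (`|f g q| * (q * l2norm x))).
  by rewrite ler_wpM2l// cauchy_schwarz_sum ?l2norm_ge0 ?sqsum_le_l2norm.
have -> : `|f g q| * (q * l2norm x) = `|q * f g q| * l2norm x.
  by rewrite normrM (ger0_norm q0) mulrA [_ * q]mulrC.
rewrite ler_piMl ?l2norm_ge0// fg// q0/=.
exact: le_trans ml al1.
Qed.

(** The vectors [X i] are normalised and live in different groups [gamma i];
    [k] is the common value of the profiles of these groups at [1 / sqrt m],
    the norm of the parts of a normalised signed sum. *)
Section SpreadVectors.
Variables (m n : nat) (gamma : nat -> nat) (k : R) (X : nat -> nat -> C).
Hypotheses (m0 : (0 < m)%N) (gamma_inj : injective gamma).
Hypothesis X_group : forall i p, X i p != 0 -> group p = gamma i.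
Hypothesis X_support : forall i p, (i < m)%N -> (n <= p)%N -> X i p = 0.
Hypothesis X_unit : forall i, (i < m)%N -> sqsum n (X i) = 1.
Hypothesis f_value : forall i, f (gamma i) (Num.sqrt m%:R)^-1 = k.

Lemma signed_sum_on_group (s : nat -> C) i p : (i < m)%N -> group p = gamma i ->
  \sum_(j < m) s j * X j p = s i * X i p.
Proof.
move=> im gp; rewrite (bigD1 (Ordinal im))//= big1 ?addr0// => j ji.
apply/eqP; rewrite mulf_eq0; apply/orP; right; apply/negPn/negP => /X_group.
rewrite gp => /gamma_inj ij; move/negP: ji; apply; apply/eqP/val_inj.
by rewrite /= ij.
Qed.

Lemma rnorm_signed_sum_ge (s : nat -> C) (z : Z) : (forall i, rnorm (s i) = 1) ->
  (val z).1 = 0 -> (val z).2 = (fun p => \sum_(i < m) s i * X i p) ->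
  k * Num.sqrt m%:R <= rnorm z.
Proof.
move=> s1 z1 z2; set x := (val z).2 in z2.
pose c : R := (Num.sqrt m%:R)^-1.
have mp : 0 < m%:R :> R by rewrite ltr0n.
have sm : 0 < Num.sqrt m%:R :> R by rewrite sqrtr_gt0.
have c0 : 0 < c by rewrite invr_gt0.
have c2 : c ^+ 2 * m%:R = 1 by rewrite exprVn sqr_sqrtr ?(ltW mp)// mulVf ?gt_eqF.
have xE i p : (i < m)%N -> group p = gamma i -> x p = s i * X i p.
  by move=> im gp; rewrite z2 (signed_sum_on_group s im gp).
have x_or p : x p = 0 \/ exists2 i, (i < m)%N & group p = gamma i.
  have [xp|xp] := eqVneq (x p) 0; [by left|right].
  have [i Xi] : exists i : 'I_m, X i p != 0.
    apply/existsP; apply: contraR xp => /existsPn h; rewrite z2 big1// => i _.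
    by have := h i; rewrite negbK => /eqP->; rewrite mulr0.
  by exists i => //; exact: X_group.
have x2 p : rnorm (x p) ^+ 2 = \sum_(i < m) rnorm (X i p) ^+ 2.
  have [[i im gp]|h] := pselect (exists2 i, (i < m)%N & group p = gamma i).
    rewrite (xE _ _ im gp) rnormM s1 mul1r (bigD1 (Ordinal im))//= big1 ?addr0// => j ji.
    have -> : X j p = 0; last by rewrite rnorm0 expr0n.
    apply/eqP/negPn/negP => /X_group; rewrite gp => /gamma_inj ij.
    by move/negP: ji; apply; apply/eqP/val_inj; rewrite /= ij.
  have [->|//] := x_or p; rewrite rnorm0 expr0n big1// => i _.
  have -> : X i p = 0; last by rewrite rnorm0 expr0n.
  by apply/eqP/negPn/negP => /X_group gp; apply: h; exists i.
have xm : sqsum n x = m%:R.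
  rewrite /sqsum; under eq_bigr do rewrite x2.
  rewrite exchange_big /= (eq_bigr (fun=> 1)); last by move=> i _; exact: X_unit.
  by rewrite sumr_const card_ord.
(* The test vector is the normalised conjugate of [x]. *)
pose a p := ((c%:C)%C : C) * (x p)^*.
have x0 p : (n <= p)%N -> x p = 0.
  by move=> np; rewrite z2 big1// => i _; rewrite X_support ?mulr0.
have a0 p : (n <= p)%N -> a p = 0 by move=> /x0; rewrite /a => ->; rewrite conjC0 mulr0.
have rc : rnorm ((c%:C)%C : C) = c by rewrite rnorm_real ger0_norm ?ltW.
have a1 : sqsum n a = 1.
  rewrite /sqsum; under eq_bigr do rewrite rnormM rnorm_conj rc exprMn.
  by rewrite -mulr_sumr -/(sqsum n x) xm.
have wa i p : (i < m)%N -> group p = gamma i -> weight group f a p = k.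
  move=> im gp; rewrite /weight gp -(f_value i); congr (f _ _).
  have supp q : (n <= q)%N -> mask group (gamma i) a q = 0.
    by move=> nq; rewrite /mask a0//; case: ifP.
  rewrite (l2norm_finite supp).2 (_ : sqsum _ _ = c ^+ 2).
    by rewrite sqrtr_sqr ger0_norm ?ltW.
  rewrite -[RHS]mulr1 -(X_unit im) /sqsum mulr_sumr; apply: eq_bigr => q _.
  rewrite /mask; case: eqP => [gq|gq].
    by rewrite /a (xE _ _ im gq) rnormM rnorm_conj rc rnormM s1 mul1r exprMn.
  have -> : X i q = 0; last by rewrite rnorm0 expr0n mulr0.
  by apply/eqP/negPn/negP => /X_group.
have := pairing_le z true a0; rewrite a1 => /(_ (lexx _)); apply: le_trans.
rewrite /pairing z1 (eq_bigr (fun p : 'I_n => (((c * k) * rnorm (x p) ^+ 2)%:C)%C)); last first.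
  move=> p _; rewrite -/x (_ : (0 : nat -> C) p = 0)// add0r.
  have [xp|[i im gp]] := x_or p; first by rewrite xp rnorm0 expr0n/= !mulr0.
  rewrite [RHS](rmorphM (real_complex R)) /= -mul_conj.
  rewrite [X in _ = X * _](rmorphM (real_complex R)) /=.
  by rewrite (wa _ _ im gp) /a; ring.
rewrite -rmorph_sum -mulr_sumr -/(sqsum n x) xm rnorm_real.
apply: le_trans (ler_norm _); rewrite le_eqVlt; apply/orP; left; apply/eqP.
rewrite -[in RHS](sqr_sqrtr (ltW mp)) /c; field; by rewrite gt_eqF.
Qed.

End SpreadVectors.

(** The subspace is spanned by [m] vectors of the second component, one in each
    group [gamma i].  They are combinations of the unit vectors at the positions
    [pos i j] of that group, with coefficients [al j] that put them in [S]. *)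
Lemma far_subspace_of_finite_codim (S : lsubspace Z) m (gamma : nat -> nat)
    (pos : nat -> nat -> nat) (k : R) :
  finite_codim S -> (0 < m)%N -> injective gamma -> (forall i, injective (pos i)) ->
  (forall i j, group (pos i j) = gamma i) ->
  (forall i s, 0 <= s <= 1 -> `|s * f (gamma i) s| <= 1) ->
  (forall i, f (gamma i) (Num.sqrt m%:R)^-1 = k) ->
  exists E : lsubspace Z, [/\ {subset carrier E <= carrier S},
    has_dim m (subspace_type E) & (k%:E <= hilbert_dist m E)%E].
Proof.
move=> codimS m0 ginj pinj pgroup fb fk.
have vmem i j : (0, unit_vector (pos i j)) \in dually_bounded (R := R) group f.
  apply/asboolP; exists (l2norm (unit_vector (R := R) (pos i j))).
  apply: (one_group_bound (fb i)) => [p|].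
    rewrite /unit_vector; case: (p =P pos i j) => [->|_]; first by rewrite pgroup.
    by rewrite eqxx.
  by apply: (bounded_square_summable (B := 1)) => n; exact: sqsum_unit_vector.
pose v i j : Z := exist _ (0, unit_vector (pos i j)) (vmem i j).
have [J [al [al1 alS]]] := combination_in_finite_codim (fun i : 'I_m => v i) codimS.
pose u (i : nat) : Z := \sum_j al j *: v i j.
pose X i : nat -> C := fun p => \sum_j al j * unit_vector (pos i j) p.
have u1 i : (val (u i)).1 = 0.
  rewrite /u raddf_sum /= (raddf_sum fst) big1// => j _ /=; by rewrite scaler0.
have u2 i : (val (u i)).2 = X i.
  rewrite /u raddf_sum /= (raddf_sum snd); apply/funext => p; rewrite fct_sumE.
  by [].
pose n := (\max_(i < m) \max_(j < J) pos i j).+1.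
have X_group i p : X i p != 0 -> group p = gamma i.
  have [[j ->]|h] := pselect (exists j : 'I_J, p = pos i j); first by rewrite pgroup.
  rewrite /X big1 ?eqxx// => j _; rewrite /unit_vector; case: eqP; rewrite ?mulr0// => pj.
  by case: h; exists j.
have pos_lt (i : nat) (j : 'I_J) : (i < m)%N -> (pos i j < n)%N.
  move=> im; rewrite ltnS.
  apply: leq_trans (leq_bigmax (F := fun i : 'I_m => \max_(j < J) pos i j) (Ordinal im)).
  exact: (leq_bigmax (F := fun j : 'I_J => pos i j)).
have X_support i p : (i < m)%N -> (n <= p)%N -> X i p = 0.
  move=> im np; rewrite /X big1// => j _; rewrite /unit_vector gtn_eqF ?mulr0//.
  exact: leq_trans (pos_lt _ j im) np.
have X_unit i : (i < m)%N -> sqsum n (X i) = 1.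
  move=> im; rewrite -al1 /sqsum.
  rewrite (eq_bigr (fun p : 'I_n => \sum_(j < J)
    (if p == pos i j :> nat then rnorm (al j) ^+ 2 else 0))); last first.
    move=> p _; have [[j pj]|h] := pselect (exists j : 'I_J, p = pos i j :> nat).
      have other (j' : 'I_J) : j' != j -> (p == pos i j' :> nat) = false.
        by move=> j'j; rewrite pj; apply: contraNF j'j => /eqP/pinj/val_inj->.
      rewrite /X (bigD1 j)//= big1 => [|j' j'j]; last first.
        by rewrite /unit_vector other ?mulr0.
      rewrite [in RHS](bigD1 j)//= [in RHS]big1 => [|j' j'j]; last by rewrite other.
      by rewrite !addr0 /unit_vector pj eqxx mulr1.
    have ne (j : 'I_J) : (p == pos i j :> nat) = false.
      by apply/eqP => pj; case: h; exists j.
    rewrite /X big1 => [|j _]; last by rewrite /unit_vector ne mulr0.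
    by rewrite rnorm0 expr0n big1 // => j _; rewrite ne.
  rewrite exchange_big; apply: eq_bigr => j _ /=.
  rewrite (bigD1 (Ordinal (pos_lt i j im)))//= eqxx big1 ?addr0// => p.
  by move=> pj; case: eqP => // pE; move/eqP: pj; case; exact: val_inj.
pose uI (i : 'I_m) := u i.
have comb2 (c : nat -> C) p : (val (\sum_(i < m) c i *: uI i)).2 p = \sum_(i < m) c i * X i p.
  by rewrite raddf_sum /= (raddf_sum snd) fct_sumE; apply: eq_bigr => i _; rewrite -u2.
have comb1 (c : nat -> C) : (val (\sum_(i < m) c i *: uI i)).1 = 0.
  rewrite raddf_sum /= (raddf_sum fst) big1// => i _.
  by change (c i *: (val (u i)).1 = 0); rewrite u1 scaler0.
exists (linear_span uI); split.
- apply: linear_span_sub => i; exact: alS.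
- apply: dim_linear_span => c c0 i.
  have [p Xp] : exists p : 'I_n, X i p != 0.
    apply/existsP; have := oner_neq0 R; apply: contraR => /existsPn h.
    rewrite -(X_unit i (ltn_ord i)) /sqsum big1// => p _.
    by have := h p; rewrite negbK => /eqP->; rewrite rnorm0 expr0n.
  pose c' j := if insub j is Some j' then c j' else 0.
  have := comb2 c' p; rewrite (signed_sum_on_group ginj X_group c' (ltn_ord i) (X_group _ _ Xp)).
  rewrite /c'; under eq_bigr do rewrite valK; rewrite c0 valK => /esym/eqP.
  by rewrite mulf_eq0 (negbTE Xp) orbF => /eqP.
- apply: (@banach_mazur_ge _ _ _ _ (span_vector uI)) => // [i|s s1].
    have -> : rnorm (span_vector uI i) = rnorm (u i) by [].
    have supp p : (n <= p)%N -> X i p = 0 by exact: X_support.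
    have [Xs XE] := l2norm_finite supp.
    have XE1 : l2norm (X i) = 1 by rewrite XE X_unit// sqrtr1.
    apply: rnorm_twisted_le; rewrite -XE1.
    have -> : val (u i) = (0, X i) by rewrite -u2 -(u1 i); case: (val (u i)).
    by apply: (one_group_bound (fb i)) => // p; exact: X_group.
  have -> : rnorm (\sum_(i < m) s i *: span_vector uI i) = rnorm (\sum_(i < m) s i *: uI i).
    by rewrite -(val_span_sum uI (fun i => s i)).
  apply: (rnorm_signed_sum_ge m0 ginj X_group X_support X_unit fk s1) => //.
  by apply/funext => p.
Qed.

End LowerBound.

(** * The choice of parameters *)

Section GrowthThresholds.
Context {R : realType}.

(** [tau k] is a time after which [delta] stays above [B k]. *)
Lemma growth_thresholds (delta : nat -> R) (B : nat -> R) : delta n @[n --> \oo] --> +oo ->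
  exists tau : nat -> nat, [/\ (0 < tau 0)%N, forall k, (tau k < tau k.+1)%N &
    forall k n, (tau k <= n)%N -> B k <= delta n].
Proof.
move=> /cvgryPge doo.
have N_ex k : exists N, forall n, (N <= n)%N -> B k <= delta n.
  by have [N _ h] := doo (B k); exists N.
have [N NP] := choice N_ex.
pose tau := fix tau k := if k is k'.+1 then maxn (tau k').+1 (N k) else maxn 1 (N 0).
exists tau; split=> [|k|k n tn]; rewrite /= ?leq_maxl//.
by apply: NP; apply: leq_trans tn; case: k => [|k] /=; rewrite leq_maxr.
Qed.

End GrowthThresholds.

Section Spread.
(** A natural number codes a triple (level, group within the level, position
    within the group); the numbers that are not codes are added to the group
    with code [(0, 0)]. *)
Definition group_of (p : nat) : nat :=
  pickle (odflt (0, 0, 0) (unpickle p : option (nat * nat * nat))).1.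
Definition level_of (g : nat) : nat := (odflt (0, 0) (unpickle g : option (nat * nat))).1.

Lemma group_of_pickle (k i j : nat) : group_of (pickle (k, i, j)) = pickle (k, i).
Proof. by rewrite /group_of pickleK. Qed.

Lemma level_of_pickle (k i : nat) : level_of (pickle (k, i)) = k.
Proof. by rewrite /level_of pickleK. Qed.
End Spread.

Unset Implicit Arguments.

Theorem proposition10 (R : realType) (delta : nat -> R)
    (delta_gt1 : forall n : nat, (1 <= n)%N -> 1 < delta n)
    (delta_infty : delta n @[n --> \oo] --> +oo) :
  exists (n0 : nat) (Z : completeNormedModType R[i]),
    [/\ (1 <= n0)%N,
        twisted_hilbert Z,
        (forall n : nat, (n0 <= n)%N ->
           (max_hilbert_dist n Z <= (delta n)%:E)%E)
      & ~ asymptotically_hilbertian Z].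
Proof.
have [tau [tau0 tauS tauP]] :=
  growth_thresholds (fun k => (3 + k%:R) * (2 + k%:R)) delta_infty.
have tau_le : {homo tau : k l / (k <= l)%N}.
  by apply: homo_leq => [//|? ? ?|k]; [exact: leq_trans | exact: ltnW].
have tau_gt k : (k < tau k)%N.
  by elim: k => [//|k IH]; exact: leq_ltn_trans IH (tauS k).
(* [2 * n * eps k <= 1] holds for [n <= tau k.+1], that is, until the bound
   for the next level becomes available. *)
pose eps k : R := (2 * (tau k.+1)%:R)^-1.
have tauR k : 0 < (tau k)%:R :> R by rewrite ltr0n (leq_ltn_trans _ (tau_gt k)).
have eps0 k : 0 < eps k by rewrite invr_gt0 mulr_gt0.
have eps_le k l : (k <= l)%N -> eps l <= eps k.
  by move=> kl; rewrite lef_pV2 ?posrE ?mulr_gt0// ler_pM2l// ler_nat tau_le.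
have eps1 k : eps k <= 1.
  rewrite invf_le1 ?mulr_gt0//.
  have : 1 <= (tau k.+1)%:R :> R by rewrite ler1n (leq_ltn_trans _ (tau_gt k.+1)).
  by move: ((tau k.+1)%:R : R) => t; lra.
pose f (g : nat) (s : R) := caplog (level_of g) (eps (level_of g)) s.
have flip g (s t : R) : 0 <= s -> 0 <= t ->
    s * t * `|f g s - f g t| <= eps (level_of g) * (s ^+ 2 + t ^+ 2).
  by apply: caplog_lipschitz; exact: ltW.
exists (tau 0), (twisted group_of f); split=> //.
- exact: twisted_hilbert_twisted flip (fun g => eps1 (level_of g)).
- move=> n n0n.
  (* [K] is the last level whose bound is available at [n]. *)
  have [K Kn Kmax] : exists2 K, (tau K <= n)%N & (n < tau K.+1)%N.
    have ex : exists K, (tau K <= n)%N by exists 0.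
    have ub K : (tau K <= n)%N -> (K <= n)%N.
      by move=> Kn; apply: leq_trans Kn; exact: ltnW.
    case: (ex_maxnP ex ub) => K Kn Kmax; exists K => //.
    by rewrite ltnNge; apply/negP => /Kmax; rewrite ltnn.
  apply: ub_ereal_sup => _ [E dimE ->].
  apply: le_trans (_ : ((3 + K%:R) * (2 + K%:R))%:E <= _)%E; last by rewrite lee_fin tauP.
  apply: (hilbert_dist_twisted_le (low := fun g => (level_of g < K)%N) flip _ (ltW (eps0 K))) => //.
  + rewrite /eps invfM mulrA mulrA -[_ * 2 * _]mulrA divff ?mulr1// ler_pdivrMr// mul1r.
    by rewrite ler_nat ltnW.
  + move=> g s lowg s01.
    have /andP[c0 c1] := caplog_bounds (level_of g) (ltW (eps0 (level_of g))) s01.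
    by rewrite ger0_norm// (le_trans c1)// ler_nat ltnW.
  + by move=> g; rewrite -leqNgt; exact: eps_le.
- move=> [c c0 AH].
  pose k := (Num.truncn c).+1.
  have ck : c < k%:R by rewrite truncnS_gt.
  have [m m0 mk] := caplog_cap k (eps0 k).
  have [S codimS SE] := AH m.
  have [|||||E [ES dimE kE]] := @far_subspace_of_finite_codim R group_of f S m
    (fun i => pickle (k, i)) (fun i j => pickle (k, i, j)) k%:R codimS m0.
  + by move=> i i' /(pcan_inj pickleK) [].
  + by move=> i j j' /(pcan_inj pickleK) [].
  + by move=> i j; exact: group_of_pickle.
  + move=> i s s01; rewrite /f; apply: caplog_small => //.
    by rewrite eps1 ltW.
  + by move=> i; rewrite /f level_of_pickle.
  have := le_trans kE (SE E ES dimE).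
  by rewrite lee_fin leNgt ck.
Qed.
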